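(* Let $(F,\partial)$ be a differential field of characteristic zero with field of constants $K$, let $G$ be a linear algebraic group over $K$, let $X$ be a $G_F$-torsor, and let $\partial\colon F[X]\to F[X]$ be a derivation extending $\partial\colon F\to F$. Then $X$ (with this derivation) is a differential $G_F$-torsor if and only if $g\circ\partial=\partial\circ g$ on $F[X]\otimes_K\overline{K}$ for all $g\in G(\overline{K})$. Here $g\in G(\overline{K})$ is viewed as the automorphism $g\colon F[X]\otimes_K\overline{K}\to F[X]\otimes_K\overline{K}$ corresponding to $X\to X$, $x\mapsto x.g$ (after base change to $\overline{K}$), and $\partial\colon F[X]\otimes_K\overline{K}\to F[X]\otimes_K\overline{K}$ is the unique extension of $\partial$.
   Context: A linear algebraic group over $K$ is an affine group scheme of finite type over $K$; $F[G]:=F\otimes_K K[G]$ is a differential ring extension of $F$ in which elements of $K[G]$ are constant. $\overline{F}$ is an algebraic closure of $F$ and $\overline{K}$ is the algebraic closure of $K$ in $\overline{F}$. The unique extension of $\partial$ to $F[X]\otimes_K\overline{K}$ is $\partial\otimes\mathrm{id}_{\overline{K}}$. A $G_F$-torsor is a non-empty affine scheme $X$ of finite type over $F$ with a right $G_F$-action such that for every $F$-algebra $R$ and all $x,y\in X(R)$ there is a unique $g\in G(R)$ with $y=x.g$. A differential $G_F$-torsor is a $G_F$-torsor $X$ with an extension of $\partial$ from $F$ to $F[X]$ such that the co-action $\rho\colon F[X]\to F[X]\otimes_F F[G]$ is a differential homomorphism (commutes with the derivations). *)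

(* Defs.v *)
From HB Require Import structures.
From mathcomp Require Import all_boot all_order all_algebra.
From mathcomp Require Import boolp.

Set Implicit Arguments.
Unset Strict Implicit.
Unset Printing Implicit Defensive.

Import GRing.Theory.
Local Open Scope ring_scope.
Local Open Scope quotient_scope.

(* Conventions.  A commutative algebra over a commutative ring k is a
   commutative ring A together with a structure map phi : {rmorphism k -> A}.
   Rings are allowed to be zero (comPzRingType) unless they must not be. *)

Section TensorDef.
Variables (k A B : comPzRingType).
Variables (phi : {rmorphism k -> A}) (psi : {rmorphism k -> B}).

Definition balanced (M : zmodType) (f : A -> B -> M) : Prop :=
  [/\ forall a a' b, f (a + a') b = f a b + f a' b,
      forall a b b', f a (b + b') = f a b + f a b'
    & forall c a b, f (phi c * a) b = f a (psi c * b)].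

Definition fsum (M : zmodType) (f : A -> B -> M) (s : seq (A * B)) : M :=
  \sum_(p <- s) f p.1 p.2.

(* The list [:: (a1, b1); ...; (an, bn)] stands for the formal sum of the
   pure tensors ai (x) bi.  Two formal sums are identified exactly when no
   k-balanced biadditive map separates them; the universal property is
   tdescE together with tensor_ext below. *)
Definition teq (s t : seq (A * B)) : bool :=
  `[< forall (M : zmodType) (f : A -> B -> M), balanced f ->
        fsum f s = fsum f t >].

Lemma teqP s t :
  reflect (forall (M : zmodType) (f : A -> B -> M), balanced f ->
             fsum f s = fsum f t) (teq s t).
Proof. exact: asboolP. Qed.

Lemma teq_refl : reflexive teq.
Proof. by move=> s; apply/teqP. Qed.

Lemma teq_sym : symmetric teq.
Proof.
by move=> s t; apply/teqP/teqP => h M f bf; rewrite (h M f bf).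
Qed.

Lemma teq_trans : transitive teq.
Proof.
move=> t s u /teqP h1 /teqP h2; apply/teqP => M f bf.
by rewrite (h1 M f bf) h2.
Qed.

Canonical teq_equiv := EquivRel teq teq_refl teq_sym teq_trans.

Definition tensor : Type := {eq_quot teq}.
HB.instance Definition _ := Choice.on tensor.

Definition tpi (s : seq (A * B)) : tensor := \pi_{eq_quot teq} s.
Definition trepr (z : tensor) : seq (A * B) := repr (z : {eq_quot teq}).

Definition tpure (a : A) (b : B) : tensor := tpi [:: (a, b)].

(* The additive map induced by f; meaningful when f is balanced. *)
Definition tdesc (M : zmodType) (f : A -> B -> M) (z : tensor) : M :=
  fsum f (trepr z).

Lemma treprK z : tpi (trepr z) = z.
Proof. exact: reprK. Qed.

Lemma tpi_eq s t : (tpi s = tpi t) <-> teq s t.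
Proof. by split=> [/eqmodP | /eqmodP]. Qed.

Lemma tdesc_pi (M : zmodType) (f : A -> B -> M) s : balanced f ->
  tdesc f (tpi s) = fsum f s.
Proof.
move=> bf; have /tpi_eq/teqP : tpi (trepr (tpi s)) = tpi s by exact: treprK.
exact.
Qed.

Lemma fsum_cat (M : zmodType) (f : A -> B -> M) s t : fsum f (s ++ t) = fsum f s + fsum f t.
Proof. by rewrite /fsum big_cat. Qed.

Lemma fsum_map (M : zmodType) (f : A -> B -> M) (g : A * B -> A * B) s :
  fsum f (map g s) = \sum_(p <- s) f (g p).1 (g p).2.
Proof. by rewrite /fsum big_map. Qed.

Lemma balanced0l (M : zmodType) (f : A -> B -> M) : balanced f -> forall b, f 0 b = 0.
Proof.
by move=> [fl _ _] b; apply: (@addrI _ (f 0 b)); rewrite -fl !addr0.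
Qed.

Lemma balanced0r (M : zmodType) (f : A -> B -> M) : balanced f -> forall a, f a 0 = 0.
Proof.
by move=> [_ fr _] a; apply: (@addrI _ (f a 0)); rewrite -fr !addr0.
Qed.

Lemma balancedNl (M : zmodType) (f : A -> B -> M) : balanced f ->
  forall a b, f (- a) b = - f a b.
Proof.
move=> bf a b; apply: (@addrI _ (f a b)); rewrite subrr.
by case: (bf) => fl _ _; rewrite -fl subrr (balanced0l bf).
Qed.

Definition sopp (s : seq (A * B)) := [seq (- p.1, p.2) | p <- s].
Definition smul (s t : seq (A * B)) :=
  [seq (p.1 * q.1, p.2 * q.2) | p <- s, q <- t].

Definition tadd (x y : tensor) : tensor := tpi (trepr x ++ trepr y).
Definition topp (x : tensor) : tensor := tpi (sopp (trepr x)).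
Definition tmul (x y : tensor) : tensor := tpi (smul (trepr x) (trepr y)).

Lemma fsum_opp (M : zmodType) (f : A -> B -> M) s : balanced f ->
  fsum f (sopp s) = - fsum f s.
Proof.
move=> bf; rewrite fsum_map /fsum -sumrN; apply: eq_bigr => p _ /=.
exact: balancedNl.
Qed.

Lemma fsum_mul (M : zmodType) (f : A -> B -> M) s t :
  fsum f (smul s t) =
  fsum (fun a b => fsum (fun a' b' => f (a * a') (b * b')) t) s.
Proof. exact: big_allpairs_dep. Qed.

Lemma balanced_mull (M : zmodType) (f : A -> B -> M) a b : balanced f ->
  balanced (fun a' b' => f (a * a') (b * b')).
Proof.
case=> fl fr fb; split=> *; rewrite ?mulrDr ?fl ?fr //.
by rewrite mulrCA fb mulrCA.
Qed.

Lemma balanced_sum (M : zmodType) (f : A -> B -> M) t : balanced f ->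
  balanced (fun a b => fsum (fun a' b' => f (a * a') (b * b')) t).
Proof.
case=> fl fr fb; split=> *; rewrite /fsum -?big_split; apply: eq_bigr => p _.
- by rewrite mulrDl fl.
- by rewrite mulrDl fr.
- by rewrite -!mulrA fb.
Qed.

Lemma tpiD s t : tpi (s ++ t) = tadd (tpi s) (tpi t).
Proof.
apply/tpi_eq/teqP => M f bf; rewrite !fsum_cat.
by rewrite -(tdesc_pi s bf) -(tdesc_pi t bf).
Qed.

Lemma tpiN s : tpi (sopp s) = topp (tpi s).
Proof.
by apply/tpi_eq/teqP => M f bf; rewrite !fsum_opp // -(tdesc_pi s bf).
Qed.

Lemma tpiM s t : tpi (smul s t) = tmul (tpi s) (tpi t).
Proof.
apply/tpi_eq/teqP => M f bf; rewrite !fsum_mul.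
rewrite -(tdesc_pi _ (balanced_sum _ bf)); apply: eq_bigr => p _.
by rewrite -(tdesc_pi t (balanced_mull _ _ bf)).
Qed.

Lemma tpiW (P : tensor -> Prop) : (forall s, P (tpi s)) -> forall z, P z.
Proof. by move=> h z; rewrite -(treprK z). Qed.

Lemma taddA : associative tadd.
Proof.
by elim/tpiW=> s; elim/tpiW=> t; elim/tpiW=> u; rewrite -!tpiD catA.
Qed.

Lemma taddC : commutative tadd.
Proof.
elim/tpiW=> s; elim/tpiW=> t; rewrite -!tpiD.
by apply/tpi_eq/teqP => M f bf; rewrite !fsum_cat addrC.
Qed.

Lemma tadd0 : left_id (tpi [::]) tadd.
Proof. by elim/tpiW=> s; rewrite -tpiD. Qed.

Lemma taddN : left_inverse (tpi [::]) topp tadd.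
Proof.
elim/tpiW=> s; rewrite -tpiN -tpiD.
apply/tpi_eq/teqP => M f bf.
by rewrite fsum_cat fsum_opp // addNr /fsum big_nil.
Qed.

HB.instance Definition _ := GRing.isZmodule.Build tensor
  taddA taddC tadd0 taddN.

Lemma tmulA : associative tmul.
Proof.
elim/tpiW=> s; elim/tpiW=> t; elim/tpiW=> u; rewrite -!tpiM.
apply/tpi_eq/teqP => M f bf; rewrite !fsum_mul /fsum.
apply: eq_bigr => p _; rewrite big_allpairs_dep; apply: eq_bigr => q _.
by apply: eq_bigr => r _; rewrite !mulrA.
Qed.

Lemma tmulC : commutative tmul.
Proof.
elim/tpiW=> s; elim/tpiW=> t; rewrite -!tpiM.
apply/tpi_eq/teqP => M f bf; rewrite !fsum_mul /fsum exchange_big.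
apply: eq_bigr => p _; apply: eq_bigr => q _.
by rewrite [p.1 * _]mulrC [p.2 * _]mulrC.
Qed.

Lemma tmul1 : left_id (tpure 1 1) tmul.
Proof.
elim/tpiW=> s; rewrite -tpiM; apply/tpi_eq/teqP => M f bf.
rewrite fsum_mul {1}/fsum big_seq1; apply: eq_bigr => p _.
by rewrite !mul1r.
Qed.

Lemma tmulDl : left_distributive tmul tadd.
Proof.
elim/tpiW=> s; elim/tpiW=> t; elim/tpiW=> u.
rewrite -(tpiD s t) -!tpiM -tpiD.
by apply/tpi_eq/teqP => M f bf; rewrite fsum_cat !fsum_mul fsum_cat.
Qed.

HB.instance Definition _ := GRing.Zmodule_isComPzRing.Build tensor
  tmulA tmulC tmul1 tmulDl.

Lemma tpureDl a a' b : tpure (a + a') b = tpure a b + tpure a' b.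
Proof.
rewrite -[RHS]tpiD; apply/tpi_eq/teqP => M f [fl _ _].
by rewrite fsum_cat /fsum !big_seq1 fl.
Qed.

Lemma tpureDr a b b' : tpure a (b + b') = tpure a b + tpure a b'.
Proof.
rewrite -[RHS]tpiD; apply/tpi_eq/teqP => M f [_ fr _].
by rewrite fsum_cat /fsum !big_seq1 fr.
Qed.

Lemma tpure_bal c a b : tpure (phi c * a) b = tpure a (psi c * b).
Proof.
by apply/tpi_eq/teqP => M f [_ _ fb]; rewrite /fsum !big_seq1 fb.
Qed.

Lemma tpure_balanced : balanced tpure.
Proof. by split; [exact: tpureDl | exact: tpureDr | exact: tpure_bal]. Qed.

Lemma tpure0l b : tpure 0 b = 0.
Proof. exact: balanced0l tpure_balanced b. Qed.

Lemma tpure0r a : tpure a 0 = 0.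
Proof. exact: balanced0r tpure_balanced a. Qed.

Lemma tpureM a b a' b' : tpure a b * tpure a' b' = tpure (a * a') (b * b').
Proof. by rewrite -[LHS]tpiM. Qed.

Lemma tpure1 : tpure 1 1 = 1.
Proof. by []. Qed.

Lemma tdescE (M : zmodType) (f : A -> B -> M) : balanced f ->
  forall a b, tdesc f (tpure a b) = f a b.
Proof. by move=> bf a b; rewrite tdesc_pi // /fsum big_seq1. Qed.

Lemma tdescD (M : zmodType) (f : A -> B -> M) : balanced f ->
  {morph tdesc f : x y / x + y}.
Proof.
move=> bf; elim/tpiW=> s; elim/tpiW=> t.
by rewrite -[tpi s + _]tpiD !tdesc_pi // fsum_cat.
Qed.

Lemma tpi_sum s : tpi s = \sum_(p <- s) tpure p.1 p.2.
Proof.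
elim: s => [|p s IH]; first by rewrite big_nil.
by rewrite big_cons -IH -cat1s [LHS]tpiD; case: p.
Qed.

Lemma tensor_ind (P : tensor -> Prop) :
  P 0 -> (forall x y, P x -> P y -> P (x + y)) ->
  (forall a b, P (tpure a b)) -> forall z, P z.
Proof.
move=> P0 PD Pp; elim/tpiW=> s; rewrite tpi_sum.
by elim/big_rec: _ => // p z _ Pz; apply: PD.
Qed.

Lemma tensor_ext (M : zmodType) (f g : tensor -> M) :
  {morph f : x y / x + y} -> {morph g : x y / x + y} ->
  (forall a b, f (tpure a b) = g (tpure a b)) -> f =1 g.
Proof.
move=> fD gD fg; elim/tensor_ind => [|x y fx fy|//]; last by rewrite fD gD fx fy.
have f0 : f 0 = 0 by apply: (@addrI _ (f 0)); rewrite -fD !addr0.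
by rewrite f0; apply: (@addrI _ (g 0)); rewrite -gD !addr0.
Qed.

Definition tinl (a : A) : tensor := tpure a 1.
Definition tinr (b : B) : tensor := tpure 1 b.

Lemma tinl_zmod : zmod_morphism tinl.
Proof.
by move=> x y; apply: (@addIr _ (tinl y)); rewrite -tpureDl !subrK.
Qed.
Lemma tinl_monoid : monoid_morphism tinl.
Proof. by split=> // x y; rewrite [RHS]tpureM mulr1. Qed.
Lemma tinr_zmod : zmod_morphism tinr.
Proof.
by move=> x y; apply: (@addIr _ (tinr y)); rewrite -tpureDr !subrK.
Qed.
Lemma tinr_monoid : monoid_morphism tinr.
Proof. by split=> // x y; rewrite [RHS]tpureM mulr1. Qed.

HB.instance Definition _ := GRing.isZmodMorphism.Build A tensor tinl tinl_zmod.
HB.instance Definition _ :=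
  GRing.isMonoidMorphism.Build A tensor tinl tinl_monoid.
HB.instance Definition _ := GRing.isZmodMorphism.Build B tensor tinr tinr_zmod.
HB.instance Definition _ :=
  GRing.isMonoidMorphism.Build B tensor tinr tinr_monoid.

Lemma tpureE a b : tpure a b = tinl a * tinr b.
Proof. by rewrite [RHS]tpureM mulr1 mul1r. Qed.

Lemma tin_base c : tinl (phi c) = tinr (psi c).
Proof. by rewrite /tinl /tinr -[phi c]mulr1 tpure_bal mulr1. Qed.

Section Lift.
Variables (R : comPzRingType) (u : {rmorphism A -> R}) (v : {rmorphism B -> R}).
Hypothesis uv : forall c, u (phi c) = v (psi c).

Definition tlift_fun : tensor -> R := tdesc (fun a b => u a * v b).

Lemma tlift_balanced : balanced (fun a b => u a * v b).
Proof.
split=> *; rewrite ?rmorphD ?mulrDl ?mulrDr //.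
by rewrite !rmorphM uv mulrCA mulrA.
Qed.

Lemma tlift_pure a b : tlift_fun (tpure a b) = u a * v b.
Proof. exact: tdescE tlift_balanced a b. Qed.

Lemma tliftD : {morph tlift_fun : x y / x + y}.
Proof. exact: tdescD tlift_balanced. Qed.

Lemma tlift0 : tlift_fun 0 = 0.
Proof. by apply: (@addrI _ (tlift_fun 0)); rewrite -tliftD !addr0. Qed.

Lemma tlift_zmod : zmod_morphism tlift_fun.
Proof.
move=> x y; apply: (@addIr _ (tlift_fun y)).
by rewrite -tliftD !subrK.
Qed.

Lemma tlift_monoid : monoid_morphism tlift_fun.
Proof.
split; first by rewrite -tpure1 tlift_pure !rmorph1 mulr1.
move=> x y; elim/tensor_ind: x => [|x x' hx hx'|a b].
- by rewrite !(mul0r, tlift0).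
- by rewrite mulrDl !tliftD hx hx' mulrDl.
elim/tensor_ind: y => [|y y' hy hy'|a' b'].
- by rewrite !(mulr0, tlift0).
- by rewrite mulrDr !tliftD hy hy' mulrDr.
by rewrite tpureM !tlift_pure !rmorphM mulrACA.
Qed.

HB.instance Definition _ :=
  GRing.isZmodMorphism.Build tensor R tlift_fun tlift_zmod.
HB.instance Definition _ :=
  GRing.isMonoidMorphism.Build tensor R tlift_fun tlift_monoid.

Definition tlift : {rmorphism tensor -> R} := tlift_fun.

Lemma tliftE a b : tlift (tpure a b) = u a * v b.
Proof. exact: tlift_pure. Qed.
Lemma tlift_inl a : tlift (tinl a) = u a.
Proof. by rewrite tliftE rmorph1 mulr1. Qed.
Lemma tlift_inr b : tlift (tinr b) = v b.
Proof. by rewrite tliftE rmorph1 mul1r. Qed.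

End Lift.

Lemma tensor_rext (R : comPzRingType) (f g : {rmorphism tensor -> R}) :
  (forall a, f (tinl a) = g (tinl a)) -> (forall b, f (tinr b) = g (tinr b)) ->
  f =1 g.
Proof.
move=> fgl fgr; apply: tensor_ext; [exact: rmorphD | exact: rmorphD |].
by move=> a b; rewrite tpureE !rmorphM fgl fgr.
Qed.

(* D1 (x) id + id (x) D2 *)
Definition tder (D1 : A -> A) (D2 : B -> B) (z : tensor) : tensor :=
  tdesc (fun a b => tpure (D1 a) b + tpure a (D2 b)) z.

End TensorDef.

Arguments tder {k A B} phi psi D1 D2 z.

Definition is_derivation (A : comPzRingType) (D : A -> A) : Prop :=
  {morph D : x y / x + y} /\ forall x y, D (x * y) = D x * y + x * D y.

Section TensorDer.
Variables (k A B : comPzRingType).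
Variables (phi : {rmorphism k -> A}) (psi : {rmorphism k -> B}).
Variables (D1 : A -> A) (D2 : B -> B).
Hypotheses (der1 : is_derivation D1) (der2 : is_derivation D2).
Hypothesis compat :
  forall c, tinl phi psi (D1 (phi c)) = tinr phi psi (D2 (psi c)).

Lemma tder_balanced :
  balanced phi psi
    (fun a b => tpure phi psi (D1 a) b + tpure phi psi a (D2 b)).
Proof.
case: der1 der2 => [D1D D1M] [D2D D2M].
split=> [a a' b|a b b'|c a b].
- by rewrite D1D !tpureDl addrACA.
- by rewrite D2D !tpureDr addrACA.
rewrite D1M D2M tpureDl tpureDr !tpure_bal -addrA [RHS]addrCA; congr (_ + _).
  have -> : tpure phi psi (D1 (phi c) * a) b =
            tinl phi psi (D1 (phi c)) * tpure phi psi a b.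
    by rewrite [RHS]tpureM mul1r.
  by rewrite compat [LHS]tpureM mul1r.
Qed.

Lemma tderE a b :
  tder phi psi D1 D2 (tpure phi psi a b) =
  tpure phi psi (D1 a) b + tpure phi psi a (D2 b).
Proof. exact: tdescE tder_balanced a b. Qed.

Lemma tderD : {morph tder phi psi D1 D2 : x y / x + y}.
Proof. exact: tdescD tder_balanced. Qed.

Lemma tder0 : tder phi psi D1 D2 0 = 0.
Proof. by apply: (@addrI _ (tder phi psi D1 D2 0)); rewrite -tderD !addr0. Qed.

Lemma tder_derivation : is_derivation (tder phi psi D1 D2).
Proof.
split; first exact: tderD.
move=> x y; elim/tensor_ind: x => [|x x' hx hx'|a b].
- by rewrite !(mul0r, tder0, addr0).
- by rewrite mulrDl !tderD hx hx' !mulrDl addrACA.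
elim/tensor_ind: y => [|y y' hy hy'|a' b'].
- by rewrite !(mulr0, tder0, addr0).
- by rewrite mulrDr !tderD hy hy' !mulrDr addrACA.
rewrite tpureM !tderE mulrDl mulrDr !tpureM.
case: der1 der2 => [_ ->] [_ ->]; rewrite tpureDl tpureDr -!addrA.
by congr (_ + _); rewrite addrCA.
Qed.

End TensorDer.

Lemma is_derivation0 (A : comPzRingType) : is_derivation (fun _ : A => 0).
Proof. by split=> x y; rewrite ?mul0r ?mulr0 addr0. Qed.

Record algHom (k A B : comPzRingType)
    (phi : {rmorphism k -> A}) (psi : {rmorphism k -> B}) := AlgHom {
  ahom :> {rmorphism A -> B};
  ahomP : forall c, ahom (phi c) = psi c }.

Section AlgHom.
Variable k : comPzRingType.

Section Comp.
Variables (A B C : comPzRingType) (phi : {rmorphism k -> A}).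
Variables (psi : {rmorphism k -> B}) (chi : {rmorphism k -> C}).
Variables (g : algHom psi chi) (f : algHom phi psi).

Lemma acomp_subproof c : (g \o f) (phi c) = chi c.
Proof. by rewrite /= !ahomP. Qed.

Definition acomp : algHom phi chi := AlgHom acomp_subproof.
End Comp.

Definition aid (A : comPzRingType) (phi : {rmorphism k -> A}) : algHom phi phi :=
  @AlgHom _ _ _ phi phi idfun (fun=> erefl).

Section Pairs.
Variables (A B R : comPzRingType).
Variables (phi : {rmorphism k -> A}) (psi : {rmorphism k -> B}).

Definition tbase : {rmorphism k -> tensor phi psi} := tinl phi psi \o phi.

Definition ainl : algHom phi tbase := @AlgHom _ _ _ phi tbase (tinl phi psi) (fun=> erefl).

Definition ainr : algHom psi tbase :=
  @AlgHom _ _ _ psi tbase (tinr phi psi) (fun c => esym (tin_base phi psi c)).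

Variables (sigma : {rmorphism k -> R}).
Variables (u : algHom phi sigma) (v : algHom psi sigma).

Lemma copair_compat c : u (phi c) = v (psi c).
Proof. by rewrite !ahomP. Qed.

Lemma copair_subproof c : tlift copair_compat (tbase c) = sigma c.
Proof. by rewrite -(ahomP u); apply: tlift_inl. Qed.

(* a (x) b |-> u a * v b, i.e. the pair (u, v) as a point of the product *)
Definition copair : algHom tbase sigma := AlgHom copair_subproof.

Lemma copair_inl a : copair (tinl phi psi a) = u a.
Proof. exact: tlift_inl. Qed.
Lemma copair_inr b : copair (tinr phi psi b) = v b.
Proof. exact: tlift_inr. Qed.
End Pairs.

Lemma copair_eq (A B R : comPzRingType) (phi : {rmorphism k -> A})
    (psi : {rmorphism k -> B}) (sigma : {rmorphism k -> R})
    (u u' : algHom phi sigma) (v v' : algHom psi sigma) :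
  u =1 u' -> v =1 v' -> copair u v =1 copair u' v'.
Proof.
move=> uu vv; apply: tensor_rext => a.
  by rewrite !copair_inl.
by rewrite !copair_inr.
Qed.

Definition finite_type (A : comPzRingType) (phi : {rmorphism k -> A}) : Prop :=
  exists s : seq A, forall P : A -> Prop,
    (forall c, P (phi c)) ->
    (forall a b, P a -> P b -> P (a + b)) ->
    (forall a b, P a -> P b -> P (a * b)) ->
    {in s, forall a, P a} -> forall a, P a.

End AlgHom.

Section PointOps.
Variables (k H : comPzRingType) (eta : {rmorphism k -> H}).
Variables (Delta : algHom eta (tbase eta eta)).
Variables (eps : algHom eta (idfun : {rmorphism k -> k})).
Variables (S : algHom eta eta).
Variables (R : comPzRingType) (sigma : {rmorphism k -> R}).

Definition pmul (g h : algHom eta sigma) : algHom eta sigma :=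
  acomp (copair g h) Delta.

Lemma pone_subproof c : (sigma \o eps) (eta c) = sigma c.
Proof. by rewrite /= ahomP. Qed.

Definition pone : algHom eta sigma := AlgHom pone_subproof.

Definition pinv (g : algHom eta sigma) : algHom eta sigma := acomp g S.
End PointOps.

Section ActOps.
Variables (k A H : comPzRingType).
Variables (phi : {rmorphism k -> A}) (eta : {rmorphism k -> H}).
Variable rho : algHom phi (tbase phi eta).
Variables (R : comPzRingType) (sigma : {rmorphism k -> R}).

Definition pact (x : algHom phi sigma) (g : algHom eta sigma) :
  algHom phi sigma := acomp (copair x g) rho.
End ActOps.

(* An affine group scheme of finite type over k, given by its coordinate ring
   and the comorphisms of multiplication, unit and inversion; the group axioms
   are stated on R-points for all commutative k-algebras R. *)
Record linAlgGroup (k : fieldType) := LinAlgGroup {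
  gring : comPzRingType;
  gstr : {rmorphism k -> gring};
  gfin : finite_type gstr;
  gcomul : algHom gstr (tbase gstr gstr);
  gcounit : algHom gstr (idfun : {rmorphism k -> k});
  gantipode : algHom gstr gstr;
  gmulA : forall (R : comPzRingType) (sigma : {rmorphism k -> R})
            (g h l : algHom gstr sigma),
    pmul gcomul g (pmul gcomul h l) =1 pmul gcomul (pmul gcomul g h) l;
  gmul1 : forall (R : comPzRingType) (sigma : {rmorphism k -> R})
            (g : algHom gstr sigma), pmul gcomul (pone gcounit sigma) g =1 g;
  gmulr1 : forall (R : comPzRingType) (sigma : {rmorphism k -> R})
            (g : algHom gstr sigma), pmul gcomul g (pone gcounit sigma) =1 g;
  gmulV : forall (R : comPzRingType) (sigma : {rmorphism k -> R})
            (g : algHom gstr sigma),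
    pmul gcomul (pinv gantipode g) g =1 pone gcounit sigma;
  gmulrV : forall (R : comPzRingType) (sigma : {rmorphism k -> R})
            (g : algHom gstr sigma),
    pmul gcomul g (pinv gantipode g) =1 pone gcounit sigma }.

Section BaseChange.
Variables (k l : fieldType) (iota : {rmorphism k -> l}) (G : linAlgGroup k).

Let H := gring G.
Let eta : {rmorphism k -> H} := gstr G.

Definition bcring : comPzRingType := tensor iota eta.
Definition bcstr : {rmorphism l -> bcring} := tinl iota eta.

(* (G_l)(R) = G(R) for every l-algebra R *)
Section Points.
Variables (R : comPzRingType) (sigma : {rmorphism l -> R}).

Lemma bcres_subproof (g : algHom bcstr sigma) c :
  (g \o tinr iota eta) (eta c) = (sigma \o iota) c.
Proof. by rewrite /= -tin_base -(ahomP g). Qed.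

Definition bcres (g : algHom bcstr sigma) :
    algHom eta (sigma \o iota : {rmorphism k -> R}) :=
  AlgHom (bcres_subproof g).

Lemma bcext_compat (g : algHom eta (sigma \o iota : {rmorphism k -> R})) c :
  sigma (iota c) = g (eta c).
Proof. by rewrite ahomP. Qed.

Definition bcext (g : algHom eta (sigma \o iota : {rmorphism k -> R})) :
    algHom bcstr sigma :=
  AlgHom (tlift_inl (bcext_compat g)).

Lemma bcext_inr g x : bcext g (tinr iota eta x) = g x.
Proof. exact: tlift_inr. Qed.

Lemma bc_eq (g h : algHom bcstr sigma) :
  (forall x, g (tinr iota eta x) = h (tinr iota eta x)) -> g =1 h.
Proof.
move=> gh; apply: tensor_rext => // c.
by rewrite -[tinl _ _ _]/(bcstr _) !ahomP.
Qed.
End Points.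

(* The product of the two universal points of G_l x G_l, i.e. the l-linear
   extension of the comultiplication of G. *)
Definition bccomul : algHom bcstr (tbase bcstr bcstr) :=
  bcext (pmul (gcomul G) (bcres (ainl bcstr bcstr)) (bcres (ainr bcstr bcstr))).

Definition bccounit : algHom bcstr (idfun : {rmorphism l -> l}) :=
  bcext (pone (gcounit G) (idfun \o iota : {rmorphism k -> l})).

Definition bcantipode : algHom bcstr bcstr :=
  bcext (pinv (gantipode G) (bcres (aid bcstr))).

Lemma bc_finite_type : finite_type bcstr.
Proof.
have [s hs] := gfin G; exists (map (tinr iota eta) s) => P Pc PD PM Ps.
have Pr x : P (tinr iota eta x).
  apply: (hs (fun x => P (tinr iota eta x))) => [c|a b|a b|a sa].
  - by rewrite -tin_base; apply: Pc.
  - by rewrite rmorphD; apply: PD.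
  - by rewrite rmorphM; apply: PM.
  - by apply: Ps; apply: map_f.
elim/tensor_ind => [|x y|a b]; last first.
- by rewrite tpureE; apply: PM => //; apply: (Pc a).
- exact: PD.
- by rewrite -(rmorph0 bcstr); apply: Pc.
Qed.

Lemma pmul_eq (R : comPzRingType) (sigma : {rmorphism k -> R})
    (g g' h h' : algHom eta sigma) : g =1 g' -> h =1 h' ->
  pmul (gcomul G) g h =1 pmul (gcomul G) g' h'.
Proof. by move=> gg hh x; apply: copair_eq. Qed.

Section BcOps.
Variables (R : comPzRingType) (sigma : {rmorphism l -> R}).

Lemma bcres_mul (g h : algHom bcstr sigma) :
  bcres (pmul bccomul g h) =1 pmul (gcomul G) (bcres g) (bcres h).
Proof.
move=> x.
rewrite -[LHS]/(copair g h (bccomul (tinr iota eta x))) bcext_inr.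
set T := copair g h.
rewrite -[LHS]/((T \o copair _ _) (gcomul G x)).
apply: tensor_rext => a.
- apply: etrans (congr1 T (copair_inl _ _ _)) _; rewrite copair_inl.
  exact: esym (copair_inl (bcres g) (bcres h) a).
- apply: etrans (congr1 T (copair_inr _ _ _)) _; rewrite copair_inr.
  exact: esym (copair_inr (bcres g) (bcres h) a).
Qed.

Lemma bcres_one :
  bcres (pone bccounit sigma) =1
  pone (gcounit G) (sigma \o iota : {rmorphism k -> R}).
Proof. by move=> x; rewrite -[LHS]/(sigma (bccounit _)) bcext_inr. Qed.

Lemma bcres_inv (g : algHom bcstr sigma) :
  bcres (pinv bcantipode g) =1 pinv (gantipode G) (bcres g).
Proof. by move=> x; rewrite -[LHS]/(g (bcantipode _)) bcext_inr. Qed.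
End BcOps.

Definition base_change : linAlgGroup l.
Proof.
apply: (@LinAlgGroup l bcring bcstr bc_finite_type
          bccomul bccounit bcantipode) => R sigma.
- move=> g h m; apply: bc_eq => x.
  apply: (etrans (bcres_mul _ _ x)); apply: esym.
  apply: (etrans (bcres_mul _ _ x)); apply: esym.
  rewrite (pmul_eq (frefl _) (bcres_mul _ _)).
  by rewrite gmulA (pmul_eq (bcres_mul _ _) (frefl _)).
- move=> g; apply: bc_eq => x; apply: (etrans (bcres_mul _ _ x)).
  by rewrite (pmul_eq (bcres_one _) (frefl _)) gmul1.
- move=> g; apply: bc_eq => x; apply: (etrans (bcres_mul _ _ x)).
  by rewrite (pmul_eq (frefl _) (bcres_one _)) gmulr1.
- move=> g; apply: bc_eq => x; apply: (etrans (bcres_mul _ _ x)).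
  by rewrite (pmul_eq (bcres_inv _) (frefl _)) gmulV -bcres_one.
- move=> g; apply: bc_eq => x; apply: (etrans (bcres_mul _ _ x)).
  by rewrite (pmul_eq (frefl _) (bcres_inv _)) gmulrV -bcres_one.
Defined.

End BaseChange.

Record torsor (k : fieldType) (G : linAlgGroup k) := Torsor {
  xring : comNzRingType;
  xstr : {rmorphism k -> xring};
  xfin : finite_type xstr;
  xcoact : algHom xstr (tbase xstr (gstr G));
  xact1 : forall (R : comPzRingType) (sigma : {rmorphism k -> R})
            (x : algHom xstr sigma),
    pact xcoact x (pone (gcounit G) sigma) =1 x;
  xactM : forall (R : comPzRingType) (sigma : {rmorphism k -> R})
            (x : algHom xstr sigma) (g h : algHom (gstr G) sigma),
    pact xcoact x (pmul (gcomul G) g h) =1 pact xcoact (pact xcoact x g) h;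
  xtors : forall (R : comPzRingType) (sigma : {rmorphism k -> R})
            (x y : algHom xstr sigma),
    exists2 g : algHom (gstr G) sigma, y =1 pact xcoact x g &
      forall g' : algHom (gstr G) sigma, y =1 pact xcoact x g' -> g =1 g' }.

Definition constant_field (K F : fieldType) (dF : F -> F)
    (iota : {rmorphism K -> F}) : Prop :=
  forall x, dF x = 0 <-> exists c, x = iota c.

Definition algebraic_closure (F : fieldType) (Fbar : closedFieldType)
    (j : {rmorphism F -> Fbar}) : Prop :=
  forall z, algebraicOver j z.

(* jbar identifies Kbar, as an extension of K, with the algebraic closure of K
   in Fbar. *)
Definition algebraic_closure_in (K Kbar : fieldType) (Fbar : fieldType)
    (jK : {rmorphism K -> Kbar}) (j : {rmorphism K -> Fbar})
    (jbar : {rmorphism Kbar -> Fbar}) : Prop :=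
  (forall c, jbar (jK c) = j c) /\
  (forall z, algebraicOver j z <-> exists w, z = jbar w).

Section DiffTorsor.
Variables (K F : fieldType) (iota : {rmorphism K -> F}) (dF : F -> F).
Variables (G : linAlgGroup K) (X : torsor (base_change iota G)).

Definition dFG : gring (base_change iota G) -> gring (base_change iota G) :=
  tder iota (gstr G) dF (fun=> 0).

Definition extends_der (dX : xring X -> xring X) : Prop :=
  forall c, dX (xstr X c) = xstr X (dF c).

Definition differential_torsor (dX : xring X -> xring X) : Prop :=
  [/\ is_derivation dX, extends_der dX
    & forall f, xcoact X (dX f) =
        tder (xstr X) (gstr (base_change iota G)) dX dFG (xcoact X f)].

Variables (Kbar : fieldType) (jK : {rmorphism K -> Kbar}).

Definition xbase : {rmorphism K -> xring X} := xstr X \o iota.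

Definition XKbar : comPzRingType := tensor xbase jK.

Definition dXKbar (dX : xring X -> xring X) : XKbar -> XKbar :=
  tder xbase jK dX (fun=> 0).

Definition XKbar_str : {rmorphism F -> XKbar} := tinl xbase jK \o xstr X.

(* the universal F[X] (x)_K Kbar -valued point of X *)
Definition xuniv : algHom (xstr X) XKbar_str :=
  @AlgHom _ _ _ (xstr X) XKbar_str (tinl xbase jK) (fun=> erefl).

Section Translation.
Variable g : algHom (gstr G) jK.

Lemma gXKbar_subproof c :
  (tinr xbase jK \o g) (gstr G c) = (XKbar_str \o iota) c.
Proof. by rewrite /= ahomP -tin_base. Qed.

(* the image of g in G_F(F[X] (x)_K Kbar) *)
Definition gXKbar : algHom (gstr (base_change iota G)) XKbar_str :=
  bcext (AlgHom gXKbar_subproof).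

Lemma gaut_compat c :
  pact (xcoact X) xuniv gXKbar (xbase c) = tinr xbase jK (jK c).
Proof. by rewrite -[xbase c]/(xstr X (iota c)) ahomP -tin_base. Qed.

(* The Kbar-algebra endomorphism whose restriction to F[X] is the point
   xuniv.g; on points it is (x, kappa) |-> (x.g, kappa), see gautE,
   gXKbar_point and gaut_inr. *)
Definition gaut : {rmorphism XKbar -> XKbar} := tlift gaut_compat.

Lemma gaut_inr c : gaut (tinr xbase jK c) = tinr xbase jK c.
Proof. exact: tlift_inr. Qed.

Section OnPoints.
Variables (R : comPzRingType) (z : {rmorphism XKbar -> R}).

Let zstr : {rmorphism F -> R} := z \o XKbar_str.
Let zhom : algHom XKbar_str zstr :=
  @AlgHom _ _ _ XKbar_str zstr z (fun=> erefl).

Lemma gautE a :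
  z (gaut (tinl xbase jK a)) =
  pact (xcoact X) (acomp zhom xuniv) (acomp zhom gXKbar) a.
Proof.
rewrite (tlift_inl gaut_compat).
rewrite -[LHS]/((z \o copair xuniv gXKbar) (xcoact X a)).
apply: tensor_rext => b.
- apply: etrans (congr1 z (copair_inl _ _ _)) _.
  exact: esym (copair_inl (acomp zhom xuniv) (acomp zhom gXKbar) b).
- apply: etrans (congr1 z (copair_inr _ _ _)) _.
  exact: esym (copair_inr (acomp zhom xuniv) (acomp zhom gXKbar) b).
Qed.

Lemma gXKbar_point h :
  acomp zhom gXKbar (tinr iota (gstr G) h) = z (tinr xbase jK (g h)).
Proof. by apply: (congr1 z); apply: bcext_inr. Qed.
End OnPoints.
End Translation.

Section WellDefined.
Variables (dX : xring X -> xring X).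
Hypotheses (dF_der : is_derivation dF) (KP : constant_field dF iota).
Hypotheses (dX_der : is_derivation dX) (dX_ext : extends_der dX).

Lemma dF_iota c : dF (iota c) = 0.
Proof. by apply/KP; exists c. Qed.

Lemma dFG_derivation : is_derivation dFG.
Proof.
apply: tder_derivation => //; first exact: is_derivation0.
by move=> c; rewrite dF_iota !rmorph0.
Qed.

Lemma dFG_str c : dFG (bcstr iota G c) = bcstr iota G (dF c).
Proof.
rewrite [LHS]tderE ?tpure0r ?addr0 //; first exact: is_derivation0.
by move=> d; rewrite dF_iota !rmorph0.
Qed.

Lemma dXG_derivation :
  is_derivation (tder (xstr X) (gstr (base_change iota G)) dX dFG).
Proof.
apply: tder_derivation; [exact: dX_der | exact: dFG_derivation |] => c.
by rewrite dX_ext tin_base dFG_str.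
Qed.

Lemma dXKbar_derivation : is_derivation (dXKbar dX).
Proof.
apply: tder_derivation => //; first exact: is_derivation0.
by move=> c; rewrite dX_ext dF_iota !rmorph0.
Qed.

Lemma dXKbarE a w :
  dXKbar dX (tpure xbase jK a w) = tpure xbase jK (dX a) w.
Proof.
rewrite [LHS]tderE ?tpure0r ?addr0 //; first exact: is_derivation0.
by move=> c; rewrite dX_ext dF_iota !rmorph0.
Qed.
End WellDefined.

End DiffTorsor.

Arguments dFG {K F iota} dF {G} z.
Arguments extends_der {K F iota} dF {G} X dX.
Arguments differential_torsor {K F iota} dF {G} X dX.
Arguments dXKbar {K F iota G} X {Kbar} jK dX z.
Arguments gaut {K F iota G} X {Kbar jK} g.

(* Main.v *)
Require Import Defs.
From HB Require Import structures.
From mathcomp Require Import all_boot all_order all_algebra.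
From mathcomp Require Import boolp classical_sets ring.

(* The coaction and the automorphisms [g] are related by evaluation: pushing
   [rho f] along [F[X] (x)_F F[G] -> F[X] (x)_K Kbar] at a point [g] gives [g f],
   and evaluation commutes with the derivations because [K[G]] and [Kbar] are
   constant.  This settles one direction, and for the other it remains to see
   that an element of [F[X] (x)_K K[G]] vanishing at all points of [G(Kbar)] is
   zero.  Contracting with [K]-linear forms on [F[X]] reduces this to elements
   of [K[G]], and base change reduces it to a group over an algebraically closed
   field [k] of characteristic zero.
   There the ideal [N] of functions vanishing at all points consists of nilpotents
   (Nullstellensatz), so it is stable under derivations.  Every tangent vector at
   a point with maximal ideal [m] extends to a derivation of [k[G]]; lifting the
   basis of the tangent space dual to elements [x_i] of [m] gives a derivation
   [E = sum x_i d_i] acting on [m^n / m^(n+1)] as multiplication by [n], and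
   [E N <= m N].  Hence [N] lies in every [m^n], and as [k[G]] is noetherian
   the powers of its maximal ideals separate elements, so [N = 0]. *)

Set Implicit Arguments.
Unset Strict Implicit.
Unset Printing Implicit Defensive.

Import GRing.Theory.
Local Open Scope ring_scope.

(** * Noetherian rings *)

Section Ideals.
Variable H : comPzRingType.

Definition ideal (I : H -> Prop) : Prop :=
  [/\ I 0, forall x y, I x -> I y -> I (x + y) & forall a x, I x -> I (a * x)].

Lemma idealN I x : ideal I -> I x -> I (- x).
Proof. by case=> _ _ IM Ix; rewrite -mulN1r; apply: IM. Qed.

Lemma idealB I x y : ideal I -> I x -> I y -> I (x - y).
Proof. by move=> idI Ix Iy; case: (idI) => _ ID _; apply: ID => //; apply: idealN. Qed.

Lemma idealDl I x y : ideal I -> I x -> I (x + y) -> I y.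
Proof. by move=> idI Ix /idealB/(_ Ix); rewrite addrC addKr; apply. Qed.

Lemma ideal_sum I (T : Type) (s : seq T) (f : T -> H) :
  ideal I -> (forall t, I (f t)) -> I (\sum_(t <- s) f t).
Proof. by case=> I0 ID _ If; elim/big_rec: _ => // t x _; apply: ID. Qed.

Definition ideal_adj (I : H -> Prop) (a : H) : H -> Prop :=
  fun x => exists2 b, I b & exists c, x = b + c * a.

Lemma ideal_adjP I a : ideal I -> ideal (ideal_adj I a).
Proof.
case=> I0 ID IM; split.
- by exists 0 => //; exists 0; rewrite mul0r addr0.
- move=> _ _ [b Ib [c ->]] [b' Ib' [c' ->]]; exists (b + b'); first exact: ID.
  by exists (c + c'); rewrite mulrDl addrACA.
- move=> u _ [b Ib [c ->]]; exists (u * b); first exact: IM.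
  by exists (u * c); rewrite mulrDr mulrA.
Qed.

Lemma ideal_adj_sub (I : H -> Prop) a x : I x -> ideal_adj I a x.
Proof. by move=> Ix; exists x => //; exists 0; rewrite mul0r addr0. Qed.

Lemma ideal_adj_gen (I : H -> Prop) a : ideal I -> ideal_adj I a a.
Proof. by case=> I0 _ _; exists 0 => //; exists 1; rewrite mul1r add0r. Qed.

Definition prime_ideal (P : H -> Prop) : Prop :=
  [/\ ideal P, ~ P 1 & forall a b, P (a * b) -> P a \/ P b].

Lemma prime_ideal_exp P a n : prime_ideal P -> P (a ^+ n) -> P a.
Proof.
move=> [_ P1 Pprime]; elim: n => [|n IHn]; first by rewrite expr0.
by rewrite exprS => /Pprime[].
Qed.

Definition noetherian : Prop :=
  forall I : nat -> H -> Prop, (forall n, ideal (I n)) ->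
    (forall n x, I n x -> I n.+1 x) ->
    exists n, forall m x, (n <= m)%N -> I m x -> I n x.

(** Without a maximal member, repeated choice of a strictly larger one would give a chain that never
    becomes stationary. *)
Lemma noetherian_max (Fam : (H -> Prop) -> Prop) I0 :
  noetherian -> (forall I, Fam I -> ideal I) -> Fam I0 ->
  exists2 I, Fam I &
    forall J, Fam J -> (forall x, I x -> J x) -> forall x, J x -> I x.
Proof.
move=> noeH Fid F0; apply: contrapT => nomax.
have step (I : {I | Fam I}) : exists J : {J | Fam J},
    (forall x, sval I x -> sval J x) /\ exists2 x, sval J x & ~ sval I x.
  case: I => I FI /=; apply: contrapT => nostep; apply: nomax.
  exists I => // J FJ IJ x Jx; apply: contrapT => nIx.
  by apply: nostep; exists (exist _ J FJ); split=> //; exists x.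
have [nxt nxtP] := choice step.
pose Is n := iter n nxt (exist _ I0 F0).
have [||n nP] := noeH (fun n => sval (Is n)).
- by move=> n; apply: Fid; apply: (svalP (Is n)).
- by move=> n; case: (nxtP (Is n)).
by have [_ [x xI []]] := nxtP (Is n); apply: (nP n.+1).
Qed.

(** An ideal [P] maximal among those containing no power of [y] is prime: if [a] and [b] lie
    outside, then [P + (a)] and [P + (b)] contain powers of [y], whose product lies in
    [P + (ab)]. *)
Lemma noetherian_prime y : noetherian -> (forall n, y ^+ n <> 0) ->
  exists2 P, prime_ideal P & ~ P y.
Proof.
move=> noeH y_nnil.
pose Fam I := ideal I /\ forall n, ~ I (y ^+ n).
have F0 : Fam (fun x => x = 0).
  split=> //; split=> [|x z -> ->|a x ->] //; first by rewrite addr0.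
  by rewrite mulr0.
have [P [idP Py] Pmax] := noetherian_max (Fam := Fam) noeH (fun I => @proj1 _ _) F0.
have adjP a : ~ P a -> exists n, ideal_adj P a (y ^+ n).
  move=> nPa; apply: contrapT => nP; apply: nPa.
  apply: (Pmax (ideal_adj P a)); last exact: ideal_adj_gen.
    by split; [apply: ideal_adjP | move=> n Pn; apply: nP; exists n].
  exact: ideal_adj_sub.
exists P; last by move/(_ 1): Py; rewrite expr1.
split=> // [|a b Pab]; first by move/(_ 0): Py; rewrite expr0.
apply: contrapT => /not_orP[/adjP[i [u Pu [c yi]]] /adjP[j [v Pv [d yj]]]].
case: (idP) => _ PD PM; apply: (Py (i + j)%N); rewrite exprD yi yj.
rewrite mulrDl [c * a * _]mulrDr [c * a * (d * b)]mulrACA [u * _]mulrC.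
by apply: PD (PM _ _ Pu) (PD _ _ (PM _ _ Pv) (PM _ _ Pab)).
Qed.

End Ideals.

Lemma noetherian_field (k : fieldType) : noetherian k.
Proof.
move=> I idI incI.
have incIm m n x : (m <= n)%N -> I m x -> I n x.
  by move/subnK<-; elim: (n - m)%N => // p IHp /IHp /incI.
have [[n [a a_neq0 Ina]]|allI] := EM (exists n, exists2 a, a != 0 & I n a).
  exists n => m x _ _; have [_ _ IM] := idI n.
  by rewrite -[x](mulfVK a_neq0); apply: IM.
exists 0 => m x _ Imx; have [->|x_neq0] := eqVneq x 0; first by case: (idI 0).
by case: allI; exists m, x.
Qed.

Lemma noetherian_surj (R H : comPzRingType) (phi : {rmorphism R -> H}) :
  (forall y, exists x, y = phi x) -> noetherian R -> noetherian H.
Proof.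
move=> phi_surj noeR I idI incI.
have [||n nP] := noeR (fun n x => I n (phi x)).
- move=> n; have [I0 ID IM] := idI n; split=> [|x y|a x]; first by rewrite rmorph0.
    by rewrite rmorphD; apply: ID.
  by rewrite rmorphM; apply: IM.
- by move=> n x; apply: incI.
by exists n => m y nm; have [x ->] := phi_surj y; apply: nP.
Qed.

(** * Hilbert's basis theorem *)

Section HilbertBasis.
Variable R : comNzRingType.

Definition coef_ideal (I : {poly R} -> Prop) (n : nat) (c : R) : Prop :=
  exists2 p, I p & (size p <= n.+1)%N /\ p`_n = c.

Lemma coef_idealP I n : ideal I -> ideal (coef_ideal I n).
Proof.
case=> I0 ID IM; split.
- by exists 0; rewrite ?size_poly0 ?coef0.
- move=> _ _ [p Ip [sp <-]] [q Iq [sq <-]]; exists (p + q); first exact: ID.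
  by rewrite coefD (leq_trans (size_polyD p q)) // geq_max sp.
- move=> a _ [p Ip [sp <-]]; exists (a *: p).
    by rewrite -mul_polyC; apply: IM.
  by rewrite coefZ (leq_trans (size_scale_leq a p)).
Qed.

Lemma coef_ideal_shift I n m c : ideal I -> (n <= m)%N ->
  coef_ideal I n c -> coef_ideal I m c.
Proof.
case=> _ _ IM nm [p Ip [sp <-]]; exists ('X^(m - n) * p); first exact: IM.
rewrite coefXnM ltnNge leq_subr /= subKn //; split=> //.
have [->|p_neq0] := eqVneq p 0; first by rewrite mulr0 size_poly0.
rewrite mulrC size_mulXn // (leq_trans (leq_add (leqnn _) sp)) //.
by rewrite addnS subnK.
Qed.

Lemma coef_ideal_sub I J : ideal I -> ideal J -> (forall x, I x -> J x) ->
  (forall n c, coef_ideal J n c -> coef_ideal I n c) -> forall p, J p -> I p.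
Proof.
move=> idI idJ IJ coefJI p; have [n] := ubnP (size p).
elim: n p => // n IHn p spn Jp.
have [->|p_neq0] := eqVneq p 0; first by case: idI.
have [|q Iq [sq qp]] := coefJI (size p).-1 (lead_coef p).
  by exists p => //; rewrite lead_coefE -polySpred.
rewrite -polySpred // in sq; rewrite lead_coefE in qp.
rewrite -[p](subrK q); case: (idI) => _ ID _; apply: ID => //.
apply: IHn; last by apply: idealB => //; apply: IJ.
apply: leq_trans (spn : (size p <= n)%N); rewrite (polySpred p_neq0) ltnS.
apply/leq_sizeP => i; rewrite leq_eqVlt coefB => /predU1P[<-|pi].
  by rewrite qp subrr.
have spi : (size p <= i)%N by rewrite (polySpred p_neq0).
by rewrite !nth_default ?subrr // (leq_trans sq).
Qed.

(** The diagonal ideals [coef_ideal (I n) n] are constant from some [n0] on; each of the finitely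
    many degrees below [n0] has its own stable index, and [N] is the largest of all these. *)
Theorem hilbert_basis : noetherian R -> noetherian {poly R}.
Proof.
move=> noeR I idI incI.
have incIm m n x : (m <= n)%N -> I m x -> I n x.
  by move/subnK<-; elim: (n - m)%N => // p IHp /IHp /incI.
have Linc m n i c : (m <= n)%N -> coef_ideal (I m) i c -> coef_ideal (I n) i c.
  by move=> mn [p Ip pc]; exists p => //; apply: incIm Ip.
have [||n0 n0P] := noeR (fun n => coef_ideal (I n) n).
- by move=> n; apply: coef_idealP.
- by move=> n c /(coef_ideal_shift (idI n) (leqnSn n)); apply: Linc.
have stab i : exists n, forall m c,
    (n <= m)%N -> coef_ideal (I m) i c -> coef_ideal (I n) i c.
  apply: (noeR (fun n => coef_ideal (I n) i)) => n; first exact: coef_idealP.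
  by move=> c; apply: Linc.
have [st stP] := choice stab.
pose N := maxn n0 (\max_(i < n0) st i).
exists N => m x Nm; apply: coef_ideal_sub => //; first by move=> y; apply: incIm.
move=> i c Lmi; have n0N : (n0 <= N)%N by apply: leq_maxl.
have [in0|n0i] := ltnP i n0.
  have stN : (st i <= N)%N.
    by rewrite leq_max (leq_bigmax (Ordinal in0)) orbT.
  exact: Linc stN (stP _ _ _ (leq_trans stN Nm) Lmi).
(* For [n0 <= i] the coefficient is carried up to the diagonal at [maxn m i], back to [n0] by
   stability, and up again to degree [i]. *)
apply: (Linc _ _ _ _ n0N); apply: (coef_ideal_shift _ n0i) => //.
apply: (n0P (maxn m i)); first by rewrite leq_max n0i orbT.
apply: (coef_ideal_shift _ (leq_maxr m i)) => //.
exact: Linc (leq_maxl m i) Lmi.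
Qed.

End HilbertBasis.

(** * Polynomial evaluation and finitely generated algebras *)

Section PolyEval.
Variables (R : comNzRingType) (H : comPzRingType).
Variables (phi : {rmorphism R -> H}) (a : H).

(* Horner evaluation does not apply here, since [H] may be the zero ring. *)
Definition peval (p : {poly R}) : H := \sum_(i < size p) phi p`_i * a ^+ i.

Lemma peval_widen n (p : {poly R}) : (size p <= n)%N ->
  peval p = \sum_(i < n) phi p`_i * a ^+ i.
Proof.
move=> sp; rewrite /peval (big_ord_widen n (fun i => phi p`_i * a ^+ i) sp).
rewrite big_mkcond; apply: eq_bigr => i _; case: ltnP => // pi.
by rewrite nth_default // rmorph0 mul0r.
Qed.

Lemma pevalD : {morph peval : p q / p + q}.
Proof.
move=> p q; rewrite (peval_widen (size_polyD p q)).
rewrite (peval_widen (leq_maxl (size p) (size q))).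
rewrite (peval_widen (leq_maxr (size p) (size q))) -big_split.
by apply: eq_bigr => i _; rewrite coefD rmorphD mulrDl.
Qed.

Lemma pevalC c : peval c%:P = phi c.
Proof.
rewrite (peval_widen (size_polyC_leq1 c)) big_ord_recl big_ord0.
by rewrite coefC eqxx mulr1 addr0.
Qed.

Lemma pevalCM c p : peval (c%:P * p) = phi c * peval p.
Proof.
have sp : (size (c%:P * p)%R <= size p)%N by rewrite mul_polyC size_scale_leq.
rewrite (peval_widen sp) mulr_sumr; apply: eq_bigr => i _.
by rewrite coefCM rmorphM mulrA.
Qed.

Lemma pevalMX p : peval (p * 'X) = peval p * a.
Proof.
have sp : (size (p * 'X)%R <= (size p).+1)%N.
  by have [->|/size_mulX->//] := eqVneq p 0; rewrite mul0r size_poly0.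
rewrite (peval_widen sp) big_ord_recl coefMX eqxx rmorph0 mul0r add0r mulr_suml.
by apply: eq_bigr => i _; rewrite coefMX /= exprSr mulrA.
Qed.

Lemma pevalX : peval 'X = a.
Proof. by rewrite -['X]mul1r pevalMX -[1]/(1%:P) pevalC rmorph1 mul1r. Qed.

Lemma peval_zmod : zmod_morphism peval.
Proof. by move=> p q; apply: (@addIr _ (peval q)); rewrite -pevalD !subrK. Qed.

Lemma peval_monoid : monoid_morphism peval.
Proof.
split=> [|p q]; first by rewrite -[1]/(1%:P) pevalC rmorph1.
elim/poly_ind: p => [|p c IHp].
  by rewrite mul0r -(polyC0 R) pevalC rmorph0 mul0r.
rewrite mulrDl !pevalD pevalC pevalCM pevalMX mulrDl mulrAC pevalMX IHp.
by rewrite mulrAC.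
Qed.

HB.instance Definition _ := GRing.isZmodMorphism.Build {poly R} H peval peval_zmod.
HB.instance Definition _ :=
  GRing.isMonoidMorphism.Build {poly R} H peval peval_monoid.

Definition peval_rmorphism : {rmorphism {poly R} -> H} := peval.

End PolyEval.

Definition generates (R H : comPzRingType) (phi : {rmorphism R -> H})
    (s : seq H) : Prop :=
  forall P : H -> Prop,
    (forall c, P (phi c)) ->
    (forall a b, P a -> P b -> P (a + b)) ->
    (forall a b, P a -> P b -> P (a * b)) ->
    {in s, forall a, P a} -> forall a, P a.

Lemma generates_nil (R H : comPzRingType) (phi : {rmorphism R -> H}) :
  generates phi [::] -> forall y, exists x, y = phi x.
Proof.
move=> gen; apply: (gen (fun y => exists x, y = phi x)) => //.
- by move=> c; exists c.
- by move=> _ _ [x ->] [y ->]; exists (x + y); rewrite rmorphD.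
- by move=> _ _ [x ->] [y ->]; exists (x * y); rewrite rmorphM.
Qed.

Lemma generates_cons (R : comNzRingType) (H : comPzRingType)
    (phi : {rmorphism R -> H}) a s :
  generates phi (a :: s) -> generates (peval_rmorphism phi a) s.
Proof.
move=> gen P Pphi PD PM Ps; apply: (gen P) => // [c|b].
  by rewrite -(pevalC phi a); apply: Pphi.
by rewrite inE => /predU1P[->|/Ps//]; rewrite -(pevalX phi a); apply: Pphi.
Qed.

Lemma noetherian_generates (H : comPzRingType) (s : seq H) :
  forall (R : comNzRingType) (phi : {rmorphism R -> H}),
    noetherian R -> generates phi s -> noetherian H.
Proof.
elim: s => [|a s IHs] R phi noeR gen.
  exact: noetherian_surj (generates_nil gen) noeR.
apply: (IHs _ (peval_rmorphism phi a)); first exact: hilbert_basis.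
exact: generates_cons.
Qed.

(** * Nullstellensatz *)

Section MkRMorphism.
Variables (A B : comPzRingType) (f : A -> B).
Hypotheses (fD : {morph f : x y / x + y}) (fM : {morph f : x y / x * y}).
Hypothesis f1 : f 1 = 1.

Let f_zmod : zmod_morphism f.
Proof. by move=> x y; apply: (@addIr _ (f y)); rewrite -fD !subrK. Qed.

Definition mk_rmorphism : {rmorphism A -> B} :=
  HB.pack f (GRing.isZmodMorphism.Build A B f f_zmod)
    (GRing.isMonoidMorphism.Build A B f (conj f1 fM)).

Lemma mk_rmorphismE x : mk_rmorphism x = f x. Proof. by []. Qed.
End MkRMorphism.

Lemma rmorphism_descend (R H k : comPzRingType) (phi : {rmorphism R -> H})
    (f : {rmorphism R -> k}) :
  (forall y, exists x, y = phi x) -> (forall x, phi x = 0 -> f x = 0) ->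
  exists g : {rmorphism H -> k}, forall x, g (phi x) = f x.
Proof.
move=> /choice[r rK] fker.
have fphi x x' : phi x = phi x' -> f x = f x'.
  move=> phixx'; apply/eqP; rewrite -subr_eq0 -rmorphB fker //.
  by rewrite rmorphB phixx' subrr.
have gphi x : f (r (phi x)) = f x by apply: fphi; rewrite -rK.
have gD : {morph (fun y => f (r y)) : x y / x + y}.
  by move=> x y; rewrite {1}(rK x) {1}(rK y) -rmorphD gphi rmorphD.
have gM : {morph (fun y => f (r y)) : x y / x * y}.
  by move=> x y; rewrite {1}(rK x) {1}(rK y) -rmorphM gphi rmorphM.
have g1 : f (r 1) = 1 by rewrite -(rmorph1 phi) gphi rmorph1.
by exists (mk_rmorphism gD gM g1) => x; rewrite mk_rmorphismE.
Qed.

Section Nullstellensatz.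
Variable k : fieldType.
Hypothesis k_closed : forall p : {poly k}, size p != 1 -> exists x, root p x.

(** A root of [p * 'X + 1] cannot be a root of [p]. *)
Lemma exists_nonroot (p : {poly k}) : p != 0 -> exists x, p.[x] != 0.
Proof.
move=> p_neq0; have [|x] := k_closed (p := p * 'X + 1).
  by rewrite size_MXaddC (negPf p_neq0) /= eqSS size_poly_eq0.
rewrite rootE !hornerE => px; exists x; apply: contraTneq px => ->.
by rewrite mul0r add0r oner_eq0.
Qed.

(** Stripping from [p] the factors shared with [q] leaves [gdcop q p]; a root of it would be a root
    of [p] but not of [q], so it is constant. *)
Lemma dvdp_exp_roots (p q : {poly k}) :
  p != 0 -> (forall x, root p x -> root q x) -> p %| q ^+ size p.
Proof.
move=> p_neq0 pq; have [->|q_neq0] := eqVneq q 0.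
  by rewrite expr0n size_poly_eq0 (negPf p_neq0) dvdp0.
have := dvdp_gdcor p q_neq0; have [|/k_closed[x]] := boolP (size (gdcop q p) == 1).
  by case/size_poly1P => c c_neq0 ->; rewrite mul_polyC dvdpZr.
by rewrite root_gdco // => /andP[/pq->].
Qed.

Lemma prime_ideal_coef (R : comNzRingType) (P : {poly R} -> Prop) p :
  ideal P -> ~ P p -> exists i, ~ P (p`_i)%:P.
Proof.
move=> idP nPp; apply: contrapT => noi; apply: nPp.
rewrite -[p]coefK poly_def; apply: ideal_sum => // i.
case: idP => _ _ PM; rewrite -mul_polyC mulrC; apply: PM.
by apply: contrapT => nPi; apply: noi; exists i.
Qed.

(** The Nullstellensatz in one variable, with [u] as the condition for extending [f]. If [P]
    contains all coefficients of its members, any [x] off the zeros of [v] serves; otherwise [x] is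
    a root of a member [q0] of least degree with a coefficient outside [P]. *)
Lemma prime_ideal_poly_root (R : comNzRingType) (P : {poly R} -> Prop) v :
  prime_ideal P -> ~ P v ->
  exists2 u : R, ~ P u%:P &
    forall f : {rmorphism R -> k}, (forall r, P r%:P -> f r = 0) -> f u != 0 ->
      exists2 x : k, forall q, P q -> (map_poly f q).[x] = 0 &
        (map_poly f v).[x] != 0.
Proof.
move=> primeP nPv; have [idP _ Pprime] := primeP.
have [allP|] := EM (forall q, P q -> forall i, P (q`_i)%:P).
  have [i nPi] := prime_ideal_coef idP nPv; exists v`_i => // f fP fi.
  have [|x vx] := @exists_nonroot (map_poly f v).
    by apply: contraNneq fi => fv0; rewrite -coef_map fv0 coef0.
  exists x => // q Pq; have -> : map_poly f q = 0.
    by apply/polyP => j; rewrite coef_map coef0; apply: fP; apply: allP.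
  exact: horner0.
move=> notallP.
pose S n := `[< exists q, [/\ P q, size q = n & exists i, ~ P (q`_i)%:P] >].
have [|n /asboolP[q0 [Pq0 sq0 [i nPi]]] minn] := @ex_minnP S.
  apply: contrapT => noS; apply: notallP => q Pq i; apply: contrapT => nPi.
  by apply: noS; exists (size q); apply/asboolP; exists q; split=> //; exists i.
have small q : P q -> (size q < size q0)%N -> forall j, P (q`_j)%:P.
  move=> Pq; rewrite sq0 => sq j; apply: contrapT => nPj.
  suff /minn : S (size q) by rewrite leqNgt sq.
  by apply/asboolP; exists q; split=> //; exists j.
have q0_neq0 : q0 != 0.
  by apply: contra_notN nPi => /eqP->; rewrite coef0; case: idP.
pose c := lead_coef q0.
have nPc : ~ P c%:P.
  move=> Pc; apply: nPi; pose q := q0 - 'X^((size q0).-1) * c%:P.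
  have Pq : P q by apply: idealB => //; case: idP => _ _; apply.
  have sq : (size q < size q0)%N.
    rewrite (polySpred q0_neq0) ltnS; apply/leq_sizeP => j.
    rewrite leq_eqVlt coefB coefMC coefXn => /predU1P[<-|qj].
      by rewrite eqxx mul1r subrr.
    by rewrite gtn_eqF // mul0r nth_default ?subrr // (polySpred q0_neq0).
  rewrite -[q0](subrK ('X^((size q0).-1) * c%:P)) coefD polyCD.
  case: (idP) => _ PD PM; apply: PD; first exact: small.
  by rewrite coefMC polyCM; apply: PM.
(* Pseudo-division scales by a power of [c], which the prime [P] does not contain, so membership in
   [P] passes between [q] and its remainder. *)
have divq0 q : exists e A B, [/\ c ^+ e *: q = A * q0 + B,
    (size B < size q0)%N & P q <-> P B].
  exists (Pdiv.Ring.rscalp q q0), (Pdiv.Ring.rdivp q q0), (Pdiv.Ring.rmodp q q0).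
  have eqq := Pdiv.ComRing.rdivp_eq q0 q; rewrite Pdiv.Ring.ltn_rmodp.
  have PA : P (Pdiv.Ring.rdivp q q0 * q0) by case: idP => _ _; apply.
  case: (idP) => _ PD PM.
  split=> //; split=> [Pq|PB].
    by apply: idealDl PA _ => //; rewrite -eqq -mul_polyC; apply: PM.
  have := PD _ _ PA PB; rewrite -eqq -mul_polyC => /Pprime[] //.
  by rewrite polyC_exp => /(prime_ideal_exp primeP).
have [e [A [B [eqv sB PvB]]]] := divq0 (v ^+ size q0).
have [j nPj] : exists j, ~ P (B`_j)%:P.
  by apply: prime_ideal_coef => // /PvB/(prime_ideal_exp primeP).
(* The factor [c] keeps the degree of [q0] under [f]. The other factor keeps the image of [B]
   nonzero, so that the image of [q0] cannot divide that of [v ^+ size q0] and has a root where [v]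
   does not vanish. *)
exists (c * B`_j); first by rewrite polyCM => /Pprime[].
move=> f fP; rewrite rmorphM mulf_eq0 negb_or => /andP[fc fj].
have sq0f : size (map_poly f q0) = size q0 by rewrite size_map_poly_id0.
have q0f_neq0 : map_poly f q0 != 0 by rewrite -size_poly_eq0 sq0f size_poly_eq0.
have [x q0x vx] : exists2 x, root (map_poly f q0) x & ~~ root (map_poly f v) x.
  apply: contrapT => noroot.
  have : map_poly f q0 %| map_poly f (v ^+ size q0).
    rewrite rmorphXn -[in X in _ %| X]sq0f; apply: dvdp_exp_roots => // x q0x.
    by apply: contrapT => /negP vx; apply: noroot; exists x.
  rewrite -(@dvdpZr _ (f c ^+ e)) ?expf_neq0 // -rmorphXn -map_polyZ eqv.
  rewrite rmorphD rmorphM dvdp_addr ?dvdp_mull // => /dvdp_leq.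
  suff -> : map_poly f B != 0.
    by move/(_ isT); rewrite sq0f leqNgt (leq_ltn_trans (size_poly _ _) sB).
  by apply: contraNneq fj => fB0; rewrite -coef_map fB0 coef0.
exists x => // q Pq; have [e' [A' [B' [eqq sB' PqB']]]] := divq0 q.
have fB' : map_poly f B' = 0.
  apply/polyP => l; rewrite coef_map coef0; apply: fP.
  by apply: small => //; apply/PqB'.
apply/eqP; rewrite -(mulrI_eq0 _ (mulfI (expf_neq0 e' fc))) -hornerZ -rmorphXn.
by rewrite -map_polyZ eqq rmorphD rmorphM /= fB' addr0 hornerM (rootP q0x) mulr0.
Qed.

(** The first generator becomes the variable of [{poly R}]; induction over that base gives a
    condition [v], which the one-variable step replaces by a condition [u] in [R]. *)
Lemma prime_ideal_extend (H : comPzRingType) (P : H -> Prop) (s : seq H) :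
  prime_ideal P ->
  forall (R : comNzRingType) (phi : {rmorphism R -> H}), generates phi s ->
  forall y, ~ P y ->
  exists2 u : R, ~ P (phi u) &
    forall f : {rmorphism R -> k},
      (forall r, P (phi r) -> f r = 0) -> f u != 0 ->
      exists g : {rmorphism H -> k},
        [/\ forall r, g (phi r) = f r, forall h, P h -> g h = 0 & g y != 0].
Proof.
move=> primeP; have [[P0 PD PM] P1 Pprime] := primeP.
elim: s => [|a s IHs] R phi gen y nPy.
  have phi_surj := generates_nil gen.
  have [u yu] := phi_surj y; exists u => [|f fP fu]; first by rewrite -yu.
  have [|g gP] := rmorphism_descend (f := f) phi_surj.
    by move=> x phix; apply: fP; rewrite phix.
  exists g; split=> [//|h|]; last by rewrite yu gP.
  by have [x ->] := phi_surj h => /fP; rewrite gP.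
have [v nPv vP] := IHs _ _ (generates_cons gen) y nPy.
pose Q (q : {poly R}) := P (peval_rmorphism phi a q).
have primeQ : prime_ideal Q.
  rewrite /Q; split; [|by rewrite rmorph1 | by move=> p q; rewrite rmorphM; apply: Pprime].
  split=> [|p q|p q]; first by rewrite rmorph0.
    by rewrite rmorphD; apply: PD.
  by rewrite rmorphM; apply: PM.
have [u nQu uP] := prime_ideal_poly_root primeQ nPv.
have QC r : Q r%:P = P (phi r) by rewrite /Q -(pevalC phi a).
exists u => [|f fP fu]; first by rewrite -QC.
have fQ r : Q r%:P -> f r = 0 by rewrite QC; apply: fP.
have [x xP vx] := uP f fQ fu.
pose fx : {rmorphism {poly R} -> k} := horner_eval x \o map_poly f.
have [||g [gphi gP gy]] := vP fx; [exact: xP | exact: vx |].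
exists g; split=> // r; rewrite -(pevalC phi a) gphi /=.
by rewrite /horner_eval map_polyC hornerC.
Qed.

(** Over a field [P] meets the scalars in zero, so the identity of [k] can be extended, the
    condition being a nonzero scalar. *)
Theorem nullstellensatz (H : comPzRingType) (eta : {rmorphism k -> H})
    (P : H -> Prop) y :
  finite_type eta -> prime_ideal P -> ~ P y ->
  exists g : algHom eta (idfun : {rmorphism k -> k}),
    (forall h, P h -> g h = 0) /\ g y != 0.
Proof.
case=> s gen primeP nPy; have [idP P1 Pprime] := primeP.
have [u nPu uP] := prime_ideal_extend primeP gen nPy.
have [||g [geta gP gy]] := uP (idfun : {rmorphism k -> k}).
- move=> r Pr; apply: contrapT => /eqP r_neq0; apply: P1.
  by case: idP => _ _ PM; rewrite -(rmorph1 eta) -(mulVf r_neq0) rmorphM; apply: PM.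
- by apply: contra_notN nPu => /eqP /= ->; rewrite rmorph0; case: idP.
by exists (AlgHom (geta : forall c, g (eta c) = (idfun : {rmorphism k -> k}) c)).
Qed.

End Nullstellensatz.

(** * Tangent vectors and derivations *)

Section DualNumbers.
Variable A : comPzRingType.

(** The pair [(a, b)] stands for [a + b eps] with [eps ^ 2 = 0]; a separate name avoids the
    componentwise product. *)
Definition dual : Type := (A * A)%type.
HB.instance Definition _ := GRing.Zmodule.on dual.

Definition dual_mul (x y : dual) : dual := (x.1 * y.1, x.1 * y.2 + x.2 * y.1).

Lemma dual_mulA : associative dual_mul.
Proof.
move=> [a a'] [b b'] [c c']; rewrite /dual_mul /= mulrA; congr pair.
by rewrite mulrDr mulrDl !mulrA addrA.
Qed.

Lemma dual_mulC : commutative dual_mul.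
Proof.
move=> [a a'] [b b']; rewrite /dual_mul /= mulrC; congr pair.
by rewrite addrC mulrC [b' * _]mulrC.
Qed.

Lemma dual_mul1 : left_id ((1, 0) : dual) dual_mul.
Proof. by move=> [a a']; rewrite /dual_mul /= !mul1r mul0r addr0. Qed.

Lemma dual_mulDl : left_distributive dual_mul +%R.
Proof.
move=> [a a'] [b b'] [c c']; rewrite /dual_mul /=; congr pair; rewrite /= mulrDl //.
by rewrite mulrDl addrACA.
Qed.

HB.instance Definition _ := GRing.Zmodule_isComPzRing.Build dual
  dual_mulA dual_mulC dual_mul1 dual_mulDl.

End DualNumbers.

Section DualMorphisms.
Variables (A B : comPzRingType).

Section Jet.
Variables (u : {rmorphism A -> B}) (D : A -> B).
Hypothesis DD : forall x y, D (x + y) = D x + D y.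
Hypothesis DM : forall x y, D (x * y) = u x * D y + D x * u y.

Let jet_fun (x : A) : dual B := (u x, D x).

Let jetD : {morph jet_fun : x y / x + y}.
Proof. by move=> x y; rewrite /jet_fun rmorphD DD. Qed.

Let jetM : {morph jet_fun : x y / x * y}.
Proof. by move=> x y; rewrite /jet_fun rmorphM DM. Qed.

Let jet1 : jet_fun 1 = 1.
Proof.
rewrite /jet_fun rmorph1; congr pair; apply: (@addrI _ (D 1)).
by rewrite addr0 -[in RHS](mulr1 1) DM rmorph1 mul1r mulr1.
Qed.

Definition jet : {rmorphism A -> dual B} := mk_rmorphism jetD jetM jet1.

Lemma jetE x : jet x = (u x, D x). Proof. by []. Qed.
End Jet.

Section DualMap.
Variable f : {rmorphism A -> B}.
Let dmap_fun (x : dual A) : dual B := (f x.1, f x.2).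
Let dmapD : {morph dmap_fun : x y / x + y}.
Proof. by move=> x y; rewrite /dmap_fun /= !rmorphD. Qed.
Let dmapM : {morph dmap_fun : x y / x * y}.
Proof. by move=> x y; rewrite /dmap_fun /= rmorphD !rmorphM. Qed.
Let dmap1 : dmap_fun 1 = 1.
Proof. by rewrite /dmap_fun /= rmorph1 rmorph0. Qed.
Definition dmap : {rmorphism dual A -> dual B} := mk_rmorphism dmapD dmapM dmap1.
Lemma dmapE x : dmap x = (f x.1, f x.2). Proof. by []. Qed.
End DualMap.
End DualMorphisms.

Section DualFst.
Variable A : comPzRingType.
Let dfst_fun (x : dual A) : A := x.1.
Let dfstD : {morph dfst_fun : x y / x + y}. Proof. by []. Qed.
Let dfstM : {morph dfst_fun : x y / x * y}. Proof. by []. Qed.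
Let dfst1 : dfst_fun 1 = 1. Proof. by []. Qed.
Definition dfst : {rmorphism dual A -> A} := mk_rmorphism dfstD dfstM dfst1.
End DualFst.

Section PointDerivations.
Variables (k : fieldType) (G : linAlgGroup k).
Let H := gring G.
Let eta : {rmorphism k -> H} := gstr G.

Lemma pmul_comp (R S : comPzRingType) (sigma : {rmorphism k -> R})
    (tau : {rmorphism k -> S}) (f : algHom sigma tau) (x y : algHom eta sigma) :
  acomp f (pmul (gcomul G) x y) =1
  pmul (gcomul G) (acomp f x) (acomp f y).
Proof.
move=> a; rewrite -[LHS]/((f \o copair x y) (gcomul G a)).
apply: tensor_rext => b.
- apply: etrans (congr1 f (copair_inl _ _ _)) _.
  exact: esym (copair_inl (acomp f x) (acomp f y) b).
- apply: etrans (congr1 f (copair_inr _ _ _)) _.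
  exact: esym (copair_inr (acomp f x) (acomp f y) b).
Qed.

Variable g : algHom eta (idfun : {rmorphism k -> k}).
Variable D : H -> k.
Hypothesis DD : forall x y, D (x + y) = D x + D y.
Hypothesis DM : forall x y, D (x * y) = g x * D y + D x * g y.
Hypothesis Deta : forall c, D (eta c) = 0.

Let jet0 (A B : comPzRingType) (u : {rmorphism A -> B}) : {rmorphism A -> dual B}.
Proof.
refine (@jet A B u (fun=> 0) _ _).
- by move=> x y; rewrite addr0.
- by move=> x y; rewrite mulr0 mul0r addr0.
Defined.

(* The [H[eps]]-point [u * (g^-1 * (g + eps D))], where [u] is the universal
   point, has the form [a |-> a + eps d(a)]; pushing it forward along [g]
   gives [g + eps D]. *)
Lemma point_derivation_lift :
  exists2 d : H -> H, is_derivation d & forall a, g (d a) = D a.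
Proof.
pose sH := jet0 eta; pose sk := jet0 (idfun : {rmorphism k -> k}).
pose u : algHom eta sH :=
  @AlgHom _ _ _ eta sH (jet0 (idfun : {rmorphism H -> H})) (fun=> erefl).
have gHP c : jet0 (eta \o g) (eta c) = sH c by rewrite !jetE /= ahomP.
pose gH : algHom eta sH := AlgHom gHP.
have gDD x y : (eta \o D) (x + y) = (eta \o D) x + (eta \o D) y.
  by rewrite /= DD rmorphD.
have gDM x y : (eta \o D) (x * y) =
    (eta \o g) x * (eta \o D) y + (eta \o D) x * (eta \o g) y.
  by rewrite /= DM rmorphD !rmorphM.
have gDP c : jet gDD gDM (eta c) = sH c by rewrite !jetE /= ahomP Deta rmorph0.
pose gD : algHom eta sH := AlgHom gDP.
pose p := pmul (gcomul G) u (pmul (gcomul G) (pinv (gantipode G) gH) gD).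
have fP c : dfst H (sH c) = eta c by [].
pose f : algHom sH eta := AlgHom fP.
(* Setting [eps = 0] turns [g + eps D] into [g], so the product collapses to [u]. *)
have p1 a : (p a).1 = a.
  rewrite -[LHS]/(acomp f p a) (pmul_comp f).
  rewrite (pmul_eq (frefl _) (pmul_comp f _ _)).
  have fgD : acomp f gD =1 acomp f gH by [].
  rewrite (pmul_eq (frefl _) (pmul_eq (frefl _) fgD)).
  rewrite (pmul_eq (frefl _) (gmulV (acomp f gH))).
  by rewrite gmulr1.
have qP c : dmap g (sH c) = sk c by rewrite dmapE /= ahomP rmorph0.
pose q : algHom sH sk := AlgHom qP.
have qp a : acomp q p a = acomp q gD a.
  rewrite (pmul_comp q) (pmul_eq (frefl _) (pmul_comp q _ _)).
  (* Applying [g] to the coefficients turns the universal point into [g], which cancels the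
     inverse. *)
  have qu : acomp q u =1 acomp q gH.
    by move=> b; rewrite -[LHS]/(g b, g 0) -[RHS]/(g (eta (g b)), g 0) ahomP.
  rewrite (pmul_eq qu (frefl _)) gmulA.
  rewrite (pmul_eq (gmulrV (acomp q gH)) (frefl _)).
  by rewrite gmul1.
exists (fun a => (p a).2) => [|a].
  split=> x y; first by rewrite rmorphD.
  by rewrite rmorphM /= !p1 addrC.
have /(congr1 snd) := qp a; rewrite /= => ->.
by rewrite ahomP.
Qed.

End PointDerivations.

(** * Ideal powers and linear forms *)

Section IdealPowers.
Variables (H : comPzRingType) (m : H -> Prop).

(** The power of [m] is the least additively closed set containing zero and the products; the
    impredicative form makes induction a plain application. *)
Fixpoint ipow (n : nat) (x : H) : Prop :=
  if n is n'.+1 then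
    forall Q : H -> Prop, Q 0 -> (forall y z, Q y -> Q z -> Q (y + z)) ->
      (forall a b, m a -> ipow n' b -> Q (a * b)) -> Q x
  else True.

Lemma ipowM n a b : m a -> ipow n b -> ipow n.+1 (a * b).
Proof. by move=> ma nb Q _ _; apply. Qed.

Lemma ipow1 a : m a -> ipow 1 a.
Proof. by move=> ma; rewrite -[a]mulr1; apply: ipowM. Qed.

Hypothesis idm : ideal m.

Lemma ipow_ideal n : ideal (ipow n).
Proof.
case: n => [|n]; first by [].
split=> [Q //|x y nx ny Q Q0 QD QM|u x nx Q Q0 QD QM].
  by apply: (QD); [apply: (nx Q) | apply: (ny Q)].
apply: (nx (fun x => Q (u * x))) => [|y z Qy Qz|a b ma nb].
- by rewrite mulr0.
- by rewrite mulrDr; apply: (QD).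
- by rewrite mulrA; apply: (QM) => //; case: idm => _ _; apply.
Qed.

Lemma ipow_decr n x : ipow n.+1 x -> ipow n x.
Proof.
by case: (ipow_ideal n) => n0 nD nM; apply=> // a b _; apply: nM.
Qed.

Lemma ipow1_sub x : ipow 1 x -> m x.
Proof.
by case: idm => m0 mD mM; apply=> // a b ma _; rewrite mulrC; apply: mM.
Qed.

Lemma ipow_exp i j x y : ipow i x -> ipow j y -> ipow (i + j) (x * y).
Proof.
elim: i x => [|i IHi] x ix jy; first by case: (ipow_ideal j) => _ _; apply.
case: (ipow_ideal (i.+1 + j)) => n0 nD nM.
apply: (ix (fun x => ipow (i.+1 + j) (x * y))) => [|u v|a b ma ib].
- by rewrite mul0r.
- by rewrite mulrDl; apply: nD.
- by rewrite -mulrA; apply: ipowM => //; apply: IHi.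
Qed.

End IdealPowers.

Lemma ipow_mono (H : comPzRingType) (m m' : H -> Prop) n x :
  (forall y, m y -> m' y) -> ipow m n x -> ipow m' n x.
Proof.
move=> mm'; elim: n x => // n IHn x nx Q Q0 QD QM; apply: (nx Q) => // a b ma nb.
by apply: (QM); [apply: mm' | apply: IHn].
Qed.

(** * Ideals generated by nilpotent elements *)

Section NilpotentGenerators.
Variables (H : comPzRingType) (J : H -> Prop).
Hypothesis idJ : ideal J.

(** Modulo [J], each block of [K] factors from [I + (x)] is a multiple of [x], because [I ^ K] dies;
    [n] blocks give a multiple of [x ^+ n], which dies as well. *)
Lemma ipow_adj (I : H -> Prop) K n x : ideal I ->
  (forall z, ipow I K z -> J z) -> J (x ^+ n) ->
  forall z, ipow (ideal_adj I x) (n * K) z -> J z.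
Proof.
move=> idI IKJ Jxn.
have [J0 JD JM] := idJ.
(* The set [J + x ^ j (I ^ i + (x))] records [j] complete blocks and [i] factors of the next. *)
pose S i j z := exists b w c,
  [/\ J b, ipow I i w & z = b + x ^+ j * (w + c * x)].
have S0 i j : S i j 0.
  exists 0, 0, 0; split=> //; last by rewrite mul0r addr0 mulr0 addr0.
  by case: (ipow_ideal idI i).
have SD i j y z : S i j y -> S i j z -> S i j (y + z).
  move=> [b [w [c [Jb iw ->]]]] [b' [w' [c' [Jb' iw' ->]]]].
  exists (b + b'), (w + w'), (c + c'); split; first exact: JD.
    by case: (ipow_ideal idI i) => _ iD _; apply: iD.
  by rewrite addrACA -mulrDr mulrDl [w + _ + _]addrACA.
have Sstep i j a z : ideal_adj I x a -> S i j z -> S i.+1 j (a * z).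
  move=> [a0 Ia0 [c0 ->]] [b [w [c [Jb iw ->]]]].
  exists ((a0 + c0 * x) * b), (a0 * w), (a0 * c + c0 * w + c0 * c * x).
  by split; [apply: JM | apply: ipowM | ring].
have SM i j z : ipow (ideal_adj I x) (j * K + i) z -> S i j z.
  elim: j i z => [|j IHj]; elim=> [|i IHi] z.
  - by move=> _; exists 0, z, 0; split=> //; rewrite mul0r add0r addr0 expr0 mul1r.
  - by apply; [exact: S0 | exact: SD | move=> a z' Ia /IHi; apply: Sstep].
  - rewrite mulSn addn0 addnC => /IHj[b [w [c [Jb /IKJ Jw ->]]]].
    exists (b + x ^+ j * w), c, 0; split=> //; first by apply: (JD) => //; apply: JM.
    by rewrite exprSr; ring.
  - rewrite addnS; apply; [exact: S0 | exact: SD |].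
    by move=> a z' Ia /IHi; apply: Sstep.
move=> z; rewrite -[(n * K)%N]addn0 => /SM[b [w [c [Jb _ ->]]]].
by apply: (JD) => //; rewrite mulrC; apply: (JM).
Qed.

Lemma ipow_nilpotent (s : seq H) : {in s, forall x, exists n, J (x ^+ n)} ->
  exists K, forall z, ipow (foldr (fun x I => ideal_adj I x) J s) K z -> J z.
Proof.
elim: s => [|x s IHs] nil_s /=.
  exists 1; have [J0 JD JM] := idJ => z; apply=> // a b Ja _.
  by rewrite mulrC; apply: (JM).
have [|K KJ] := IHs; first by move=> y ys; apply: nil_s; rewrite inE ys orbT.
have [|n xn] := nil_s x; first by rewrite inE eqxx.
exists (n * K)%N; apply: ipow_adj => //.
by elim: (s) => // y t; apply: ideal_adjP.
Qed.

End NilpotentGenerators.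

(** * Linear forms and dual bases *)

Section LinearForms.
Variables (k : fieldType) (A : comPzRingType) (phi : {rmorphism k -> A}).

Definition subspace (W : A -> Prop) : Prop :=
  [/\ W 0, forall x y, W x -> W y -> W (x + y)
    & forall c x, W x -> W (phi c * x)].

Definition linear_form (l : A -> k) : Prop :=
  (forall x y, l (x + y) = l x + l y) /\ forall c x, l (phi c * x) = c * l x.

Definition subspace_adj (W : A -> Prop) (v : A) : A -> Prop :=
  fun x => exists c, W (x - phi c * v).

Lemma subspaceN W x : subspace W -> W x -> W (- x).
Proof. by case=> _ _ WZ Wx; rewrite -mulN1r -(rmorph1 phi) -rmorphN; apply: (WZ). Qed.

Lemma subspaceB W x y : subspace W -> W x -> W y -> W (x - y).
Proof. by move=> sW Wx Wy; case: (sW) => _ WD _; apply: (WD) => //; apply: subspaceN. Qed.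

Lemma subspace_adjP W v : subspace W -> subspace (subspace_adj W v).
Proof.
case=> W0 WD WZ; split.
- by exists 0; rewrite rmorph0 mul0r subr0.
- move=> x y [c Wc] [d Wd]; exists (c + d).
  by rewrite rmorphD mulrDl opprD addrACA; apply: (WD).
- by move=> c x [d Wd]; exists (c * d); rewrite rmorphM -mulrA -mulrBr; apply: (WZ).
Qed.

Lemma subspace_adj_sub W v x : W x -> subspace_adj W v x.
Proof. by move=> Wx; exists 0; rewrite rmorph0 mul0r subr0. Qed.

Lemma subspace_adj_gen W v : subspace W -> subspace_adj W v v.
Proof. by case=> W0 _ _; exists 1; rewrite rmorph1 mul1r subrr. Qed.

(* If [r] is linear modulo [W] with values in [W + k v], its coefficient along
   [v] is a linear form. *)
Lemma linear_form_coef W v (r : A -> A) : subspace W -> ~ W v ->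
  (forall x y, W (r (x + y) - (r x + r y))) ->
  (forall c x, W (r (phi c * x) - phi c * r x)) ->
  (forall x, subspace_adj W v (r x)) ->
  exists2 l, linear_form l & forall x, W (r x - phi (l x) * v).
Proof.
move=> sW nWv rD rZ /choice[l lP]; exists l => //.
have [W0 WD WZ] := sW.
have uniq c d x : W (x - phi c * v) -> W (x - phi d * v) -> c = d.
  move=> Wc Wd; apply/eqP; rewrite -subr_eq0; apply: contra_notT nWv => cd.
  have := subspaceB sW Wd Wc.
  rewrite opprB addrC addrA subrK -mulrBl -rmorphB.
  by move/(WZ (c - d)^-1); rewrite mulrA -rmorphM mulVf // rmorph1 mul1r.
split=> [x y|c x]; apply: uniq (lP _) _.
  rewrite -[r _](subrK (r x + r y)) -addrA; apply: (WD) => //.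
  by rewrite rmorphD mulrDl opprD addrACA; apply: (WD).
rewrite -[r _](subrK (phi c * r x)) -addrA; apply: (WD) => //.
by rewrite rmorphM -mulrA -mulrBr; apply: (WZ).
Qed.

(** Forms dual modulo [W + k v] leave a remainder [r x] in [W + k v]; if [v] is not in [W], its
    coefficient along [v] is the one new form. *)
Lemma dual_basis (s : seq A) W : subspace W ->
  (forall x, foldl subspace_adj W s x) ->
  exists2 t : seq (A * (A -> k)),
    (forall i, (i < size t)%N ->
       let p := nth (0, fun=> 0) t i in
       linear_form p.2 /\ forall x, W x -> p.2 x = 0) &
    forall x, W (x - \sum_(p <- t) phi (p.2 x) * p.1).
Proof.
elim: s W => [|v s IHs] W sW span.
  by exists [::] => // x; rewrite big_nil subr0; apply: span.
have [W0 WD WZ] := sW.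
have [t tP tW] := IHs _ (subspace_adjP v sW) span.
have [Wv|nWv] := EM (W v).
  exists t => [i it p|x].
    by have [lin van] := tP i it; split=> // x Wx; apply/van/subspace_adj_sub.
  have [c] := tW x; set y := _ - \sum_(p <- t) _ => Wy.
  by rewrite -[y](subrK (phi c * v)); apply: (WD) => //; apply: (WZ).
pose r x := x - \sum_(p <- t) phi (p.2 x) * p.1.
have rD x y : r (x + y) = r x + r y.
  rewrite /r addrACA -opprD -big_split; congr (_ - _).
  rewrite !(big_nth (0, fun=> 0)) !big_mkord.
  by apply: eq_bigr => i _; have [[lD _] _] := tP i (ltn_ord i); rewrite lD rmorphD mulrDl.
have rZ c x : r (phi c * x) = phi c * r x.
  rewrite /r mulrBr mulr_sumr; congr (_ - _).
  rewrite !(big_nth (0, fun=> 0)) !big_mkord.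
  by apply: eq_bigr => i _; have [[_ lZ] _] := tP i (ltn_ord i); rewrite lZ rmorphM mulrA.
have [x y|c x|//|l linl lP] := linear_form_coef sW nWv (r := r).
- by rewrite rD subrr.
- by rewrite rZ subrr.
exists ((v, l) :: t) => [[_ /=|i it]|x].
- split=> // x Wx; apply/eqP; apply: contra_notT nWv => lx.
  have rx : r x = x.
    rewrite /r (big_nth (0, fun=> 0)) big_mkord big1 ?subr0 // => i _.
    have [_ van] := tP i (ltn_ord i).
    by rewrite van ?rmorph0 ?mul0r //; apply: subspace_adj_sub.
  have := subspaceB sW Wx (lP x); rewrite rx opprB addrC subrK.
  by move/(WZ (l x)^-1); rewrite mulrA -rmorphM mulVf // rmorph1 mul1r.
- by have [lin van] := tP i it; split=> // x Wx; apply/van/subspace_adj_sub.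
- by rewrite big_cons opprD addrA addrAC; apply: lP.
Qed.

End LinearForms.

Lemma derivation0 (A : comPzRingType) (d : A -> A) : is_derivation d -> d 0 = 0.
Proof. by case=> dD _; apply: (@addrI _ (d 0)); rewrite -dD !addr0. Qed.

Lemma derivation1 (A : comPzRingType) (d : A -> A) : is_derivation d -> d 1 = 0.
Proof.
case=> _ dM; apply: (@addrI _ (d 1)).
by rewrite addr0 -[in RHS](mulr1 1) dM mul1r mulr1.
Qed.

(* From [y ^+ n.+1 * d y ^+ e = 0], differentiating and multiplying by [d y]
   trades one factor [y] for two factors [d y]. *)
Lemma derivation_nilpotent (A : comPzRingType) (d : A -> A) y n :
  is_derivation d -> (forall m x, x *+ m.+1 = 0 :> A -> x = 0) ->
  y ^+ n = 0 -> exists m, d y ^+ m = 0.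
Proof.
move=> derd char0 yn; have [dD dM] := derd.
have dX x j : d (x ^+ j) = (x ^+ j.-1 * d x) *+ j.
  elim: j => [|j IHj]; first by rewrite expr0 mulr0n derivation1.
  rewrite exprS dM IHj mulrnAr mulrA mulrS [d x * _]mulrC /=.
  by case: j {IHj} => [|j]; rewrite ?mulr0n // -exprS.
suff main j e : y ^+ j * d y ^+ e = 0 -> exists m, d y ^+ m = 0.
  by apply: (main n 0); rewrite yn mul0r.
elim: j e => [|j IHj] e ye; first by exists e; rewrite -[LHS]mul1r -(expr0 y).
apply: (IHj e.+2); apply: (char0 j).
have := congr1 (fun z => d z * d y) ye.
rewrite (derivation0 derd) mul0r dM !dX mulrDl /= => <-.
rewrite -[LHS]addr0; congr (_ + _).
  by rewrite !mulrnAl -!mulrA -exprSr -exprS.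
case: e ye => [|e] ye; first by rewrite mulr0n mulr0 mul0r.
rewrite mulrnAr mulrnAl /= -[_ * _ * d y]mulrA -[_ * d (d y) * d y]mulrA.
by rewrite [d (d y) * d y]mulrC [_ * (d y * _)]mulrA -exprSr mulrA ye mul0r mul0rn.
Qed.

(** * Points separate functions in characteristic zero *)

(** With [a] and [b] the values of [x] and [y] at a point, products become linear modulo the square
    of its maximal ideal. *)
Lemma mul_shift (A : comPzRingType) (x y a b : A) :
  x * y = (x - a) * (y - b) + (a * y + (b * x - a * b)).
Proof. ring. Qed.

Section PointSeparation.
Variables (k : fieldType) (G : linAlgGroup k).
Hypothesis k_closed : forall p : {poly k}, size p != 1 -> exists x, root p x.
Hypothesis k_char0 : [pchar k] =i pred0.
Let H := gring G.
Let eta : {rmorphism k -> H} := gstr G.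
Let point := algHom eta (idfun : {rmorphism k -> k}).

Let vanish (h : H) : Prop := forall g : point, g h = 0.

Let gring_noetherian : noetherian H.
Proof.
by have [s gen] := gfin G; apply: noetherian_generates gen; apply: noetherian_field.
Qed.

Let mulrn_divK n (h : H) : eta n.+1%:R^-1 * (h *+ n.+1) = h.
Proof.
have n_neq0 : n.+1%:R != 0 :> k by move/pcharf0P: k_char0 => ->.
by rewrite mulrnAr -mulrnAl -rmorphMn -mulr_natr mulVf // rmorph1 mul1r.
Qed.

Let mulrn_eq0 n (h : H) : h *+ n.+1 = 0 -> h = 0.
Proof. by move=> hn; rewrite -(mulrn_divK n h) hn mulr0. Qed.

Let vanish_nilpotent h : vanish h -> exists n, h ^+ n = 0.
Proof.
move=> hvan; apply: contrapT => hnil.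
have [|P primeP nPh] := noetherian_prime (y := h) gring_noetherian.
  by move=> n hn; apply: hnil; exists n.
have [g [_ /negP]] := nullstellensatz k_closed (gfin G) primeP nPh.
by rewrite hvan eqxx.
Qed.

Let nilpotent_vanish h n : h ^+ n = 0 -> vanish h.
Proof.
move=> hn g; apply/eqP.
have : g h ^+ n.+1 == 0 by rewrite -rmorphXn exprS hn mulr0 rmorph0.
by rewrite expf_eq0.
Qed.

Let vanish_derivation d h : is_derivation d -> vanish h -> vanish (d h).
Proof.
move=> derd /vanish_nilpotent[n hn].
have [m] := derivation_nilpotent derd mulrn_eq0 hn.
exact: nilpotent_vanish.
Qed.

Section AtPoint.
Variable g : point.
Let m (h : H) : Prop := g h = 0.

Lemma point_kernel_ideal : ideal m.
Proof.
rewrite /m; split=> [|x y gx gy|a x gx]; first exact: rmorph0.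
  by rewrite rmorphD gx gy addr0.
by rewrite rmorphM gx mulr0.
Qed.
Let idm := point_kernel_ideal.

Let mB h : m (h - eta (g h)).
Proof. by rewrite /m rmorphB ahomP subrr. Qed.

(** A dual basis modulo [k + m ^ 2] consists of tangent vectors at [g]. Their lifts to derivations
    of the group ring still serve modulo [m ^ 2], where only their values at [g] matter. *)
Lemma cotangent_dual_basis :
  exists2 t : seq (H * (H -> H)),
    (forall i, (i < size t)%N -> let p := nth (0, idfun) t i in
       m p.1 /\ is_derivation p.2) &
    forall h, m h -> ipow m 2 (h - \sum_(p <- t) p.1 * p.2 h).
Proof.
have [m20 m2D m2M] := ipow_ideal idm 2.
pose W h := exists c, ipow m 2 (h - eta c).
have sW : subspace eta W.
  split=> [|x y [c xc] [d yd]|c x [d xd]].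
  - by exists 0; rewrite rmorph0 subr0.
  - by exists (c + d); rewrite rmorphD opprD addrACA; apply: (m2D).
  - by exists (c * d); rewrite rmorphM -mulrBr; apply: m2M.
have m2W x y : W ((x - eta (g x)) * (y - eta (g y))).
  by exists 0; rewrite rmorph0 subr0; apply: ipowM => //; apply: ipow1.
have Weta c : W (eta c) by exists c; rewrite subrr.
have [s gen] := gfin G.
pose s' := [seq x - eta (g x) | x <- s].
have foldP (V : H -> Prop) r : subspace eta V ->
    [/\ subspace eta (foldl (subspace_adj eta) V r),
        forall x, V x -> foldl (subspace_adj eta) V r x &
        {in r, forall x, foldl (subspace_adj eta) V r x}].
  elim: r V => [|x r IHr] V sV; first by split.
  have [sV' VV' rV'] := IHr _ (subspace_adjP x sV).
  split=> // [y Vy|y]; first by apply/VV'/subspace_adj_sub.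
  rewrite inE => /predU1P[->|/rV'//]; apply/VV'.
  exact: subspace_adj_gen.
have [sV WV s'V] := foldP W s' sW.
have [V0 VD VZ] := sV.
have [|t tP tW] := dual_basis (s := s') sW.
  (* The shifted generators and [W] span everything, since [mul_shift] makes the span closed under
     products. *)
  apply: gen => [c|a b Va Vb|a b Va Vb|a sa]; first exact: WV.
  - exact: VD.
  - rewrite (mul_shift a b (eta (g a)) (eta (g b))).
    apply: (VD); first by apply/WV/m2W.
    apply: (VD); first exact: VZ.
    apply: (VD); first exact: VZ.
    by apply: (subspaceN sV); apply: VZ; apply: WV.
  - rewrite -[a](subrK (eta (g a))); apply: (VD); last exact: WV.
    by apply: s'V; apply: map_f.
have Dlift i : exists d : H -> H, (i < size t)%N ->
    is_derivation d /\ forall a, g (d a) = (nth (0, fun=> 0) t i).2 a.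
  have [it|] := ltnP i (size t); last by exists idfun.
  have [[lD lZ] lW] := tP i it.
  have leta c : (nth (0, fun=> 0) t i).2 (eta c) = 0 by apply/lW.
  have [||//|d derd gd] := @point_derivation_lift k G g (nth (0, fun=> 0) t i).2.
  - exact: lD.
  - move=> x y; set l := (nth _ t i).2 in lD lZ lW leta *.
    rewrite (mul_shift x y (eta (g x)) (eta (g y))) !lD !lZ (lW _ (m2W x y)).
    by rewrite -rmorphM -rmorphN leta add0r addr0 [g y * _]mulrC.
  by exists d.
have [d dP] := choice Dlift.
pose x0 i := (nth (0, fun=> 0) t i).1.
pose t' := mkseq (fun i => (x0 i - eta (g (x0 i)), d i)) (size t).
exists t' => [i|h mh].
  rewrite size_mkseq => it; rewrite nth_mkseq //=; split; first exact: mB.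
  by case: (dP i it).
(* A member of [m] in [k + m ^ 2] has constant part zero, so it suffices to compare modulo [W]. *)
have WP z : W z -> m z -> ipow m 2 z.
  move=> [c zc] mz; have := ipow1_sub idm (ipow_decr idm zc).
  rewrite /m rmorphB mz ahomP => /(congr1 -%R); rewrite opprB subr0 oppr0 => /= c0.
  by move: zc; rewrite c0 rmorph0 subr0.
have [W0 WD WZ] := sW.
apply: WP; last first.
  rewrite /m rmorphB mh sub0r rmorph_sum big_map big1 ?oppr0 // => i _.
  by rewrite rmorphM /= mB mul0r.
have := tW h; rewrite (big_nth (0, fun=> 0)) /index_iota subn0 big_map.
set A := \sum_(i <- _) _ => WA; rewrite -(subrKA A); apply: (WD) => //.
rewrite /A -sumrB big_seq; apply: (big_ind W) => // i.
rewrite mem_iota => /dP[_ gd] /=; rewrite /x0.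
set x := (nth _ t i).1; set l := (nth _ t i).2 in gd *.
(* The first summand lies in [m ^ 2], because [eta (l h) - d i h] vanishes at [g]; the second is
   constant. *)
have -> : eta (l h) * x - (x - eta (g x)) * d i h =
    (x - eta (g x)) * (eta (l h) - d i h) + eta (l h * g x).
  by rewrite rmorphM; ring.
apply: (WD) => //; exists 0; rewrite rmorph0 subr0; apply: ipowM => //.
by apply: ipow1; rewrite /m rmorphB ahomP gd /= subrr.
Qed.

(** The Euler derivation [E] fixes members of [m] modulo [m ^ 2]; by the product rule each of [n]
    factors contributes once. *)
Lemma euler_ipow (t : seq (H * (H -> H))) :
  (forall i, (i < size t)%N -> let p := nth (0, idfun) t i in
     m p.1 /\ is_derivation p.2) ->
  (forall h, m h -> ipow m 2 (h - \sum_(p <- t) p.1 * p.2 h)) ->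
  forall n h, ipow m n h -> ipow m n.+1 (\sum_(p <- t) p.1 * p.2 h - h *+ n).
Proof.
move=> tP tm; pose E h := \sum_(p <- t) p.1 * p.2 h.
have Esum h : E h =
    \sum_(i < size t) (nth (0, idfun) t i).1 * (nth (0, idfun) t i).2 h.
  by rewrite /E (big_nth (0, idfun)) big_mkord.
have Em h : m (E h).
  rewrite Esum; apply: ideal_sum => // i; have [mi _] := tP i (ltn_ord i).
  by case: idm => _ _ mM; rewrite mulrC; apply: mM.
have ED x y : E (x + y) = E x + E y.
  rewrite !Esum -big_split; apply: eq_bigr => i _.
  by have [_ [dD _]] := tP i (ltn_ord i); rewrite dD mulrDr.
have EM x y : E (x * y) = E x * y + x * E y.
  rewrite !Esum mulr_suml mulr_sumr -big_split; apply: eq_bigr => i _.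
  have [_ [_ dM]] := tP i (ltn_ord i); rewrite dM /=; ring.
have E0 : E 0 = 0 by apply: (@addrI _ (E 0)); rewrite -ED !addr0.
elim=> [|n IHn] h nh; rewrite -/(E h).
  by rewrite mulr0n subr0; apply: ipow1.
have [n0 nD nM] := ipow_ideal idm n.+2.
apply: (nh (fun h => ipow m n.+2 (E h - h *+ n.+1))) => [|x y Qx Qy|a b ma nb].
- by rewrite E0 mul0rn subr0.
- by rewrite ED mulrnDl opprD addrACA; apply: nD.
(* The error terms lie in [m ^ 2 m ^ n] and in [m m ^ (n + 1)]. *)
have -> : E (a * b) - (a * b) *+ n.+1 = - (a - E a) * b + a * (E b - b *+ n).
  by rewrite EM mulrS mulrBr mulrnAr; ring.
apply: nD; last by apply: ipowM => //; apply: IHn.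
rewrite mulNr; apply: (idealN (ipow_ideal idm n.+2)).
exact: (ipow_exp idm (tm a ma) nb).
Qed.

(** The derivatives of [h] vanish at all points too, so by induction the Euler sum lies one power
    deeper; modulo that power it is a positive multiple of [h], and characteristic zero permits
    division. *)
Lemma vanish_ipow n h : vanish h -> ipow m n h.
Proof.
have [t tP tm] := cotangent_dual_basis.
(* The first power is treated apart, as the Euler derivation would only give a multiple by 0. *)
elim: n h => [//|n IHn] h hvan; case: n IHn => [|n] IHn.
  by apply: ipow1; apply: hvan.
have [n0 nD nM] := ipow_ideal idm n.+2.
have nE : ipow m n.+2 (\sum_(p <- t) p.1 * p.2 h).
  rewrite (big_nth (0, idfun)) big_mkord.
  apply: (ideal_sum _ (ipow_ideal idm n.+2)) => i.
  have [mi di] := tP i (ltn_ord i); apply: ipowM => //.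
  by apply: IHn; apply: vanish_derivation.
have := idealB (ipow_ideal idm n.+2) nE (euler_ipow tP tm (IHn h hvan)).
rewrite opprB addrC subrK => nh.
by rewrite -(mulrn_divK n h); apply: nM.
Qed.

Lemma point_kernel_gen (J : H -> Prop) s : ideal J -> generates eta s -> forall h,
  foldr (fun x I => ideal_adj I x) J [seq x - eta (g x) | x <- s] (h - eta (g h)).
Proof.
move=> idJ gen; set V := foldr _ _ _.
have idV (r : seq H) : ideal (foldr (fun x I => ideal_adj I x) J r).
  by elim: r => // x r; apply: ideal_adjP.
have [V0 VD VM] : ideal V by apply: idV.
apply: (gen (fun h => V (h - eta (g h)))) => [c|a b Va Vb|a b Va Vb|a].
- by rewrite ahomP subrr.
- by rewrite !rmorphD opprD addrACA; apply: VD.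
- have -> : a * b - eta (g (a * b)) =
      b * (a - eta (g a)) + eta (g a) * (b - eta (g b)).
    by rewrite !rmorphM; ring.
  by apply: VD; apply: VM.
- rewrite /V; elim: (s) => // x r IHr; rewrite inE => /predU1P[->|/IHr] /=.
    exact: ideal_adj_gen.
  exact: ideal_adj_sub.
Qed.

End AtPoint.

(** Let [J] be maximal among the ideals missing [h]. The annihilator of [h] modulo [J] is the kernel
    of a point and has a power inside [J], yet [h] lies in every power of it. *)
Theorem points_separate h : vanish h -> h = 0.
Proof.
move=> hvan; apply: contrapT => h_neq0.
pose Fam I := ideal I /\ ~ I h.
have F0 : Fam (fun x => x = 0).
  split=> //; split=> [|x z -> ->|a x ->] //; first by rewrite addr0.
  by rewrite mulr0.
have [J [idJ nJh] Jmax] :=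
  noetherian_max (Fam := Fam) gring_noetherian (fun I => @proj1 _ _) F0.
have [J0 JD JM] := idJ.
have adjJ a : ~ J a -> exists b c, J b /\ h = b + c * a.
  move=> nJa; suff : ideal_adj J a h by case=> b Jb [c hE]; exists b, c.
  apply: contrapT => nadj; apply: nJa; apply: (Jmax (ideal_adj J a)).
  - by split=> //; apply: ideal_adjP.
  - exact: ideal_adj_sub.
  - exact: ideal_adj_gen.
(* This annihilator is prime because every ideal larger than [J] contains [h]. *)
pose m a := J (a * h).
have primem : prime_ideal m.
  split=> [||a b mab]; last 2 first.
  - by rewrite /m mul1r.
  - have [ma|/adjJ[u [c [Ju hE]]]] := EM (m a); [by left | right].
    rewrite /m hE mulrDr; apply: (JD); first exact: JM.
    by rewrite mulrCA [b * _]mulrA [b * a]mulrC; apply: JM.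
  - rewrite /m; split=> [|x y mx my|a x mx]; first by rewrite mul0r.
      by rewrite mulrDl; apply: JD.
    by rewrite -mulrA; apply: JM.
have [_ m1 _] := primem.
have [g [gm _]] := nullstellensatz k_closed (gfin G) primem m1.
have kerg x : g x = 0 -> m x.
  move=> gx; apply: contrapT => /adjJ[u [c [Ju hE]]].
  have /gm/eqP : m (1 - c * x).
    by rewrite /m mulrBl mul1r -mulrA {1}hE addrK.
  by rewrite rmorphB rmorph1 rmorphM gx mulr0 subr0 oner_eq0.
have nilm a : m a -> exists n, J (a ^+ n).
  (* The ideals [(J : a ^ n)] become stationary. If [a ^ n] were outside [J], then [h = u + c a ^ n]
     with [a h] in [J] would put [c] in the next of them, hence [c a ^ n] and [h] in [J]. *)
  move=> ma; have [||n nP] := gring_noetherian (I := fun n b => J (a ^+ n * b)).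
  - move=> n; split=> [|x y Jx Jy|c x Jx]; first by rewrite mulr0.
      by rewrite mulrDr; apply: JD.
    by rewrite mulrCA; apply: JM.
  - by move=> n x Jx; rewrite exprS -mulrA; apply: JM.
  exists n; apply: contrapT => /adjJ[u [c [Ju hE]]]; apply: (nJh).
  rewrite hE; apply: (JD) => //; rewrite mulrC; apply: (nP n.+1) => //.
  have -> : a ^+ n.+1 * c = a * h - a * u by rewrite hE exprS; ring.
  by apply: idealB => //; apply: JM.
have [s gen] := gfin G.
have [|K KJ] := ipow_nilpotent idJ (s := [seq x - eta (g x) | x <- s]).
  move=> _ /mapP[x _ ->]; apply: nilm; apply: kerg.
  by rewrite rmorphB ahomP subrr.
apply/nJh/KJ; apply: ipow_mono (vanish_ipow g K hvan) => x gx.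
by have := point_kernel_gen g idJ gen x; rewrite gx rmorph0 subr0.
Qed.
End PointSeparation.

(** * Tensor products and translations *)

(** Zorn's lemma gives a maximal subspace [U] containing [W] and missing [v]; it is a complement of
    the line of [v], and the form is the coefficient along [v]. *)
Lemma linear_form_separates (k : fieldType) (A : comPzRingType)
    (phi : {rmorphism k -> A}) (W : A -> Prop) v :
  subspace phi W -> ~ W v ->
  exists2 l, linear_form phi l & (forall x, W x -> l x = 0) /\ l v = 1.
Proof.
move=> sW nWv.
pose good (U : set A) :=
  [/\ subspace phi U, forall x, W x -> U x & ~ U v].
(* The empty set is admitted because [Zorn_bigcup] considers empty chains. *)
have [|U [Ugood Umax]] := @Zorn_bigcup A (fun U => (exists x, U x) -> good U).
  move=> F Fgood Ftot [x0 [U0 FU0 U0x0]].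
  have goodF U x : F U -> U x -> good U by move=> FU Ux; apply: Fgood => //; exists x.
  have [[U00 _ _] WU0 _] := goodF _ _ FU0 U0x0.
  split=> [|x Wx|[U FU Uv]]; last by have [_ _] := goodF _ _ FU Uv; apply.
    split=> [|x y [U FU Ux] [V FV Vy]|c x [U FU Ux]]; first by exists U0.
      have [[_ UD _] _ _] := goodF _ _ FU Ux; have [[_ VD _] _ _] := goodF _ _ FV Vy.
      case: (Ftot U V FU FV) => [UV|VU]; first by exists V => //; apply/VD/Vy/UV.
      by exists U => //; apply: UD => //; apply: VU.
    by have [[_ _ UZ] _ _] := goodF _ _ FU Ux; exists U => //; apply: UZ.
  by exists U0 => //; apply: WU0.
have {}Ugood : good U.
  apply: Ugood; apply: contrapT => U0; apply: (Umax W) => //.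
  split=> [|WU]; first by move=> x Ux; case: U0; exists x.
  by case: sW => W0 _ _; case: U0; exists 0; apply: WU.
have [sU WU nUv] := Ugood; have [U0 UD UZ] := sU.
(* For [x] outside [U], maximality puts [v] into [U + k x] with a nonzero coefficient, and one
   solves for [x]. *)
have Uadj x : subspace_adj phi U v x.
  have [Ux|nUx] := EM (U x); first exact: subspace_adj_sub.
  have [[c Uc]|nadj] := EM (subspace_adj phi U x v).
    have c_neq0 : c != 0.
      by apply: contra_notN nUv => /eqP c0; move: Uc; rewrite c0 rmorph0 mul0r subr0.
    exists c^-1; have := subspaceN sU (UZ c^-1 _ Uc).
    by rewrite mulrBr mulrA -rmorphM mulVf // rmorph1 mul1r opprB.
  case: (Umax (subspace_adj phi U x)).
    split=> [y|Uadj]; first exact: subspace_adj_sub.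
    exact/nUx/Uadj/subspace_adj_gen.
  move=> _; split=> //; first exact: subspace_adjP.
  by move=> y /WU; apply: subspace_adj_sub.
have [x y|c x|//|l linl lP] := linear_form_coef sU nUv (r := id).
- by rewrite subrr.
- by rewrite subrr.
have Uv0 c : U (phi c * v) -> c = 0.
  move=> Uc; apply/eqP; apply: contra_notT nUv => c_neq0.
  by have := UZ c^-1 _ Uc; rewrite mulrA -rmorphM mulVf // rmorph1 mul1r.
exists l => //; split=> [x /WU Ux|].
  by apply: Uv0; have := subspaceB sU Ux (lP x); rewrite opprB addrC subrK.
apply/eqP; rewrite eq_sym -subr_eq0; apply/eqP; apply: Uv0.
by rewrite rmorphB rmorph1 mulrBl mul1r.
Qed.

(** * Contraction of tensors *)

Section TensorSeparation.
Variables (k : fieldType) (A B : comPzRingType).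
Variables (phi : {rmorphism k -> A}) (psi : {rmorphism k -> B}).

(** The map [l (x) id], with [k (x) B] identified with [B]. *)
Definition contract (l : A -> k) (w : tensor phi psi) : B :=
  tdesc (fun a b => psi (l a) * b) w.

Lemma contract_balanced l : linear_form phi l ->
  balanced phi psi (fun a b => psi (l a) * b).
Proof.
case=> lD lZ; split=> [a a' b|a b b'|c a b].
- by rewrite lD rmorphD mulrDl.
- by rewrite mulrDr.
- by rewrite lZ rmorphM mulrAC mulrA mulrC mulrA.
Qed.

Lemma contractD l : linear_form phi l -> {morph contract l : x y / x + y}.
Proof. by move=> linl; apply: tdescD; apply: contract_balanced. Qed.

Lemma contract_pure l a b : linear_form phi l ->
  contract l (tpure phi psi a b) = psi (l a) * b.
Proof. by move=> linl; apply: (tdescE (contract_balanced linl)). Qed.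

Lemma contract0 l : linear_form phi l -> contract l 0 = 0.
Proof.
by move=> linl; rewrite -(tpure0r phi psi 0) contract_pure // mulr0.
Qed.

Let span (s : seq A) : A -> Prop :=
  foldr (fun v W => subspace_adj phi W v) (fun x => x = 0) s.

Let span_subspace s : subspace phi (span s).
Proof.
elim: s => [|v s IHs]; last exact: subspace_adjP.
by split=> [//|x y -> ->|c x ->]; rewrite ?addr0 ?mulr0.
Qed.

Let span_mem s : {in s, forall x, span s x}.
Proof.
elim: s => // v s IHs x; rewrite inE => /predU1P[->|/IHs].
  exact: subspace_adj_gen.
exact: subspace_adj_sub.
Qed.

Let span_absorb s a b : span [seq p.1 | p <- s] a ->
  exists2 t, size t = size s &
    tpure phi psi a b + tpi phi psi s = tpi phi psi t.
Proof.
elim: s a => [|[a1 b1] s IHs] a /=.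
  by move=> ->; exists [::] => //; rewrite tpure0l add0r.
move=> [c /IHs[t st tE]]; exists ((a1, psi c * b + b1) :: t); first by rewrite /= st.
have -> : tpure phi psi a b =
    tpure phi psi (phi c * a1) b + tpure phi psi (a - phi c * a1) b.
  by rewrite -tpureDl addrC subrK.
rewrite !tpi_sum !big_cons /= -!tpi_sum -tE tpureDr -tpure_bal.
exact: addrACA.
Qed.

(** Induction on the number of terms: a left factor dependent on the others is absorbed; otherwise a
    form equal to 1 on it and 0 on the others shows its right factor to be zero. *)
Lemma contract_separates (w : tensor phi psi) :
  (forall l, linear_form phi l -> contract l w = 0) -> w = 0.
Proof.
rewrite -(treprK w); move: (trepr w) => {w} s.
have [n] := ubnP (size s); elim: n s => // n IHn [|[a b] s] sn lw.
  by rewrite tpi_sum big_nil.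
have sE : tpi phi psi ((a, b) :: s) = tpure phi psi a b + tpi phi psi s.
  by rewrite !tpi_sum big_cons.
have [sa|nsa] := EM (span [seq p.1 | p <- s] a).
  have [t st tE] := span_absorb b sa; rewrite sE tE; apply: IHn => [|l linl].
    by rewrite st.
  by rewrite -tE -sE; apply: lw.
have [l linl [l0 la]] := linear_form_separates (span_subspace _) nsa.
have b0 : b = 0.
  have := lw l linl; rewrite sE contractD // contract_pure // la rmorph1 mul1r.
  rewrite /contract tdesc_pi; last exact: contract_balanced.
  rewrite /fsum big_seq big1 ?addr0 // => p ps.
  by rewrite l0 ?rmorph0 ?mul0r //; apply/span_mem/map_f.
have sE' : tpi phi psi ((a, b) :: s) = tpi phi psi s by rewrite sE b0 tpure0r add0r.
rewrite sE'; apply: IHn => // l' linl'; rewrite -sE'; exact: lw.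
Qed.

End TensorSeparation.

(** A root in [Fbar] of a nonzero polynomial over [Kbar] is algebraic over [K], hence already in
    [Kbar]. *)
Lemma algebraic_closure_in_closed (K : fieldType) (Fbar : closedFieldType)
    (Kbar : fieldType) (jK : {rmorphism K -> Kbar}) (j : {rmorphism K -> Fbar})
    (jbar : {rmorphism Kbar -> Fbar}) :
  algebraic_closure_in jK j jbar ->
  forall p : {poly Kbar}, size p != 1 -> exists x, root p x.
Proof.
case=> _ algP p p_size; have [->|p_neq0] := eqVneq p 0.
  by exists 0; apply: root0.
have /closed_rootP[z pz] : size (map_poly jbar p) != 1 by rewrite size_map_poly.
have [w zE] : exists w, z = jbar w.
  apply/algP/integral_algebraic; apply: integral_root pz _.
    by rewrite map_poly_eq0.
  move=> c /(nthP 0)[i _ <-]; rewrite coef_map.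
  by apply/integral_algebraic/algP; exists p`_i.
by exists w; move: pz; rewrite zE fmorph_root.
Qed.

(** * Points over an algebraically closed extension *)

Section GeometricPoints.
Variables (K Kbar : fieldType) (jK : {rmorphism K -> Kbar}) (G : linAlgGroup K).
Hypothesis Kbar_closed : forall p : {poly Kbar}, size p != 1 -> exists x, root p x.
Hypothesis Kbar_char0 : [pchar Kbar] =i pred0.

(** Base change to [Kbar] makes the points rational and shows [1 (x) h] to be zero; a [K]-linear
    form on [Kbar] with value 1 at 1 recovers [h] from it. *)
Theorem geometric_points_separate (h : gring G) :
  (forall g : algHom (gstr G) jK, g h = 0) -> h = 0.
Proof.
move=> hvan; have h1 : tpure jK (gstr G) 1 h = 0.
  apply: (@points_separate _ (base_change jK G)) => // g.
  exact: (hvan (@AlgHom _ _ _ (gstr G) jK (bcres g) (ahomP (bcres g)))).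
have s0 : subspace jK (fun x => x = 0).
  by split=> [//|x y -> ->|c x ->]; rewrite ?addr0 ?mulr0.
have [|l linl [_ l1]] := linear_form_separates s0 (v := 1).
  by apply/eqP/oner_neq0.
have := contract_pure (gstr G) 1 h linl.
by rewrite h1 contract0 // l1 rmorph1 mul1r => ->.
Qed.

Variables (A : comPzRingType) (phi : {rmorphism K -> A}).

Lemma geometric_compat (g : algHom (gstr G) jK) c :
  tinl phi jK (phi c) = (tinr phi jK \o g) (gstr G c).
Proof. by rewrite /= ahomP tin_base. Qed.

Lemma tensor_geometric_points_separate (w : tensor phi (gstr G)) :
  (forall g, tlift (geometric_compat g) w = 0) -> w = 0.
Proof.
move=> wvan; apply: contract_separates => l linl.
apply: geometric_points_separate => g.
have <- : contract l (tlift (geometric_compat g) w) = g (contract l w).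
  move: w {wvan}; apply: tensor_ext => [x y|x y|a b].
  - by rewrite rmorphD contractD.
  - by rewrite contractD // rmorphD.
  - by rewrite tliftE [_ * _]tpureM mulr1 mul1r !contract_pure // rmorphM ahomP.
by rewrite wvan contract0.
Qed.
End GeometricPoints.

(** * Evaluation of the coaction at a point *)

Section Translation.
Variables (K F : fieldType) (iota : {rmorphism K -> F}) (dF : F -> F).
Variables (G : linAlgGroup K) (X : torsor (base_change iota G)).
Variables (Kbar : fieldType) (jK : {rmorphism K -> Kbar}).
Let eta := gstr (base_change iota G).

(** This is [a (x) b |-> a b(g)], from [F[X] (x)_F F[G]] to [F[X] (x)_K Kbar]. *)
Definition evalG (g : algHom (gstr G) jK) :=
  copair (xuniv X jK) (gXKbar X g).

Lemma gaut_inl g a : gaut X g (tinl (xbase X) jK a) = evalG g (xcoact X a).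
Proof. exact: tlift_inl. Qed.

Lemma evalG_pure g a b :
  evalG g (tpure (xstr X) eta a b) = tinl (xbase X) jK a * gXKbar X g b.
Proof. by rewrite tpureE rmorphM copair_inl copair_inr. Qed.

Lemma flatten_compat c :
  tinl (xstr X) eta (xbase X c) = (tinr (xstr X) eta \o tinr iota (gstr G)) (gstr G c).
Proof. by rewrite /= -tin_base -[tinr _ _ _]tin_base. Qed.

(** The comparison map from [F[X] (x)_K K[G]] brings tensors over [F] back to tensors over [K],
    where points separate. *)
Lemma flatten_surj z : exists w, z = tlift flatten_compat w.
Proof.
elim/tensor_ind: z => [|_ _ [w ->] [w' ->]|a b]; first by exists 0; rewrite rmorph0.
  by exists (w + w'); rewrite rmorphD.
elim/tensor_ind: b => [|b b' [w bE] [w' bE']|c h].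
- by exists 0; rewrite rmorph0 tpure0r.
- by exists (w + w'); rewrite rmorphD tpureDr bE bE'.
exists (tpure _ _ (xstr X c * a) h); rewrite tliftE [RHS]tpureM mulr1 mul1r.
by rewrite tpure_bal; congr (tpure _ _ a _); rewrite [RHS]tpureM mulr1 mul1r.
Qed.

Lemma evalG_flatten g w :
  evalG g (tlift flatten_compat w) = tlift (geometric_compat (xbase X) g) w.
Proof.
move: w; apply: tensor_ext => [x y|x y|a h]; first by rewrite !rmorphD.
  by rewrite rmorphD.
rewrite !tliftE rmorphM copair_inl copair_inr; congr (_ * _).
exact: bcext_inr.
Qed.

Lemma evalG_separates z :
  (forall p : {poly Kbar}, size p != 1 -> exists x, root p x) ->
  [pchar Kbar] =i pred0 -> (forall g, evalG g z = 0) -> z = 0.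
Proof.
move=> Kbar_closed Kbar_char0; have [w -> zvan] := flatten_surj z.
suff -> : w = 0 by rewrite rmorph0.
apply: (tensor_geometric_points_separate Kbar_closed Kbar_char0) => g.
exact: etrans (esym (evalG_flatten g w)) (zvan g).
Qed.

Variables (dX : xring X -> xring X).
Hypotheses (dF_der : is_derivation dF) (KP : constant_field dF iota).
Hypotheses (dX_der : is_derivation dX) (dX_ext : extends_der dF X dX).

Lemma gXKbar_der g b : gXKbar X g (dFG dF b) = dXKbar X jK dX (gXKbar X g b).
Proof.
have [dKD dKM] := dXKbar_derivation jK KP dX_der dX_ext.
have [dGD _] := dFG_derivation G dF_der KP.
move: b; apply: tensor_ext => [x y|x y|c h]; first by rewrite dGD rmorphD.
  by rewrite rmorphD dKD.
have gE c' : gXKbar X g (tpure iota (gstr G) c' h) =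
    tpure (xbase X) jK (xstr X c') (g h).
  rewrite tpureE rmorphM [RHS]tpureE; congr (_ * _); first exact: ahomP.
  exact: bcext_inr.
rewrite gE (dXKbarE jK KP dX_der dX_ext) dX_ext -gE; congr (gXKbar X g _).
rewrite [LHS]tderE ?tpure0r ?addr0 //; first exact: is_derivation0.
by move=> d; rewrite (dF_iota KP) !rmorph0.
Qed.

Lemma evalG_der g z :
  evalG g (tder (xstr X) eta dX (dFG dF) z) = dXKbar X jK dX (evalG g z).
Proof.
have [dKD dKM] := dXKbar_derivation jK KP dX_der dX_ext.
have [dTD dTM] := dXG_derivation dF_der KP dX_der dX_ext.
move: z; apply: tensor_ext => [x y|x y|a b]; first by rewrite dTD rmorphD.
  by rewrite rmorphD dKD.
rewrite tderE; last first.
- by move=> c; rewrite dX_ext tin_base (dFG_str _ dF_der KP).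
- exact: dFG_derivation.
- exact: dX_der.
rewrite rmorphD !evalG_pure dKM gXKbar_der; congr (_ * _ + _).
exact: esym (dXKbarE jK KP dX_der dX_ext a 1).
Qed.

End Translation.

(** * The criterion for differential torsors *)

Theorem lemma1p2
  (F : fieldType) (dF : F -> F) (dF_der : is_derivation dF)
  (charF0 : [pchar F] =i pred0)
  (K : fieldType) (iota : {rmorphism K -> F}) (KP : constant_field dF iota)
  (Fbar : closedFieldType) (jF : {rmorphism F -> Fbar})
  (FbarP : algebraic_closure jF)
  (Kbar : fieldType) (jK : {rmorphism K -> Kbar})
  (jbar : {rmorphism Kbar -> Fbar})
  (KbarP : algebraic_closure_in jK (jF \o iota) jbar)
  (G : linAlgGroup K) (X : torsor (base_change iota G))
  (dX : xring X -> xring X)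
  (dX_der : is_derivation dX) (dX_ext : extends_der dF X dX) :
  differential_torsor dF X dX <->
  (forall (g : algHom (gstr G) jK) (z : XKbar X jK),
     gaut X g (dXKbar X jK dX z) = dXKbar X jK dX (gaut X g z)).
Proof.
have dK_der := dXKbar_derivation jK KP dX_der dX_ext; have [dKD dKM] := dK_der.
have dKE := dXKbarE jK KP dX_der dX_ext.
split=> [[_ _ rho_der] g|gaut_der].
  apply: tensor_ext => [x y|x y|a c]; first by rewrite dKD rmorphD.
    by rewrite rmorphD dKD.
  (* The factor from [Kbar] is fixed by [g] and killed by the derivation, which leaves the identity
     on [F[X]]. *)
  rewrite dKE !tpureE !rmorphM !gaut_inl rho_der evalG_der // gaut_inr dKM.
  by rewrite [X in _ = _ + _ * X]dKE (derivation1 dX_der) tpure0l mulr0 addr0.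
split=> // f; apply/eqP; rewrite -subr_eq0; apply/eqP.
apply: (evalG_separates (jK := jK)) => [||g].
- exact: algebraic_closure_in_closed KbarP.
- by move=> p; rewrite (fmorph_pchar jK) -(fmorph_pchar iota) charF0.
rewrite rmorphB evalG_der // -!gaut_inl -gaut_der.
by rewrite (dKE f 1 : _ (tinl _ _ f) = _) subrr.
Qed.
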